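(* Let $\mathscr C$ be a $1$-category. The strict $2$-functor $\mathbf{PC}(-):\mathsf{Bicat}(\mathscr C^{\mathrm{op}},\mathbf{Cat})\to\mathbf{Cat}$ lifts to a strict $2$-functor $$\mathbf{PC}:\mathfrak{Tan}\bigl(\mathsf{Bicat}(\mathscr C^{\mathrm{op}},\mathbf{Cat})\bigr)\to\mathfrak{Tan}$$ making the square of $2$-categories commute strictly: $$\mathrm{Forget}\circ\mathbf{PC}=\mathbf{PC}(-)\circ\mathrm{Forget}:\mathfrak{Tan}\bigl(\mathsf{Bicat}(\mathscr C^{\mathrm{op}},\mathbf{Cat})\bigr)\to\mathbf{Cat},$$ where $\mathrm{Forget}:\mathfrak{Tan}(\mathsf{Bicat}(\mathscr C^{\mathrm{op}},\mathbf{Cat}))\to\mathsf{Bicat}(\mathscr C^{\mathrm{op}},\mathbf{Cat})$ and $\mathrm{Forget}:\mathfrak{Tan}\to\mathbf{Cat}$ are the forgetful $2$-functors.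
   Context: $\mathsf{Bicat}(\mathscr C^{\mathrm{op}},\mathbf{Cat})$ is the $2$-category of normalized pseudofunctors, pseudonatural transformations and modifications. Tangent categories. A tangent structure $\mathbb T=(T,p,0,+,\ell,c)$ on a category $\mathscr D$ consists of a functor $T:\mathscr D\to\mathscr D$ and natural transformations $p:T\Rightarrow\mathrm{id}$, $0:\mathrm{id}\Rightarrow T$, $+:T_2\Rightarrow T$, $\ell:T\Rightarrow T^2$, $c:T^2\Rightarrow T^2$ such that: (1) for every object $A$ and $n\in\mathbb N$ the $n$-fold pullback power $T_nA$ of $p_A:TA\to A$ exists and is preserved by all $T^m$; (2) $(p_A,+_A,0_A)$ is a commutative monoid in $\mathscr D_{/A}$; (3) $T(p_A)\ell_A=0_Ap_A$, $\ell_A\circ{+_A}=T(+_A)\circ\langle\ell_A\pi_1,\ell_A\pi_2\rangle$, $\ell_A0_A=T(0_A)0_A$; (4) $p_{TA}c_A=T(p_A)$, $c_A\circ T(+_A)={+_{TA}}\circ\langle c_AT(\pi_1),c_AT(\pi_2)\rangle$, $c_AT(0_A)=0_{TA}$; (5) $c_Ac_A=\mathrm{id}$, $c_A\ell_A=\ell_A$, $T(\ell_A)\ell_A=\ell_{TA}\ell_A$, $c_{TA}T(c_A)c_{TA}=T(c_A)c_{TA}T(c_A)$, $c_{TA}T(c_A)\ell_{TA}=T(\ell_A)c_A$; (6) $T(+_A)\circ\langle\ell_A\pi_1,0_{TA}\pi_2\rangle:T_2A\to T^2A$ is an equalizer of $T(p_A)$ and $0_A\,p_A\,p_{TA}:T^2A\rightrightarrows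 TA$. $\mathfrak{Tan}$ is the $2$-category of tangent categories; a $1$-cell $(\mathscr D,\mathbb T)\to(\mathscr E,\mathbb S)$, $\mathbb S=(S,q,0',\oplus,\ell',c')$, is a (lax) tangent morphism $(H,\alpha)$: a functor $H$ and natural $\alpha:HT\Rightarrow SH$ with $(q H)\alpha=Hp$, $\alpha (H0)=0'H$, $\alpha (H{+})=(\oplus H)\alpha_2$, $(\ell' H)\alpha=(S\alpha)(\alpha T)(H\ell)$, $(c'H)(S\alpha)(\alpha T)=(S\alpha)(\alpha T)(Hc)$; composition $(G,\beta)(H,\alpha)=(GH,(\beta H)(G\alpha))$. A $2$-cell $(H,\alpha)\Rightarrow(K,\beta)$ is a natural transformation $\rho:H\Rightarrow K$ with $(S\rho)\alpha=\beta(\rho T)$. $\mathfrak{Tan}(\mathcal K)$, for a $2$-category $\mathcal K$ (Lanfranchi). Objects are tangent objects: an object $X$ with a $1$-cell $T:X\to X$ and $2$-cells $p:T\Rightarrow\mathrm{id}_X$, $0:\mathrm{id}_X\Rightarrow T$, $\mathrm{add}:T_2\Rightarrow T$, $\ell:T\Rightarrow T^2$, $c:T^2\Rightarrow T^2$ satisfying the axioms of a tangent category read in $\mathcal K(X,X)$: the pullback powers $T_n$ of $p$ exist, are preserved by post-composition with all $T^m$, and are pointwise (preserved by $\mathcal K(f,X)$ for all $f:X'\to X$); $(T,\mathrm{add},0)$ is a commutative monoid over $\mathrm{id}_X$; equations (3)–(5) hold with $T(-)$, $(-)_T$ read as whiskerings; and the square formed by $(T\ast\mathrm{add})\langle\ell\pi_1,(0\ast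 T)\pi_2\rangle:T_2\Rightarrow T^2$, $p\pi_1:T_2\Rightarrow\mathrm{id}_X$, $T\ast p:T^2\Rightarrow T$, $0:\mathrm{id}_X\Rightarrow T$ is a pointwise pullback. $1$-cells $(X,\mathbb T)\to(Y,\mathbb S)$ are pairs $(h,\alpha)$ with $h:X\to Y$ and $\alpha:h\circ T\Rightarrow S\circ h$ satisfying the same five equations as a tangent morphism above; $2$-cells $(h,\alpha)\Rightarrow(k,\beta)$ are $2$-cells $\rho:h\Rightarrow k$ of $\mathcal K$ with $(S\ast\rho)\alpha=\beta(\rho\ast T)$. The $2$-functor $\mathbf{PC}$. For $F:\mathscr C^{\mathrm{op}}\to\mathbf{Cat}$ with compositors $\phi_{f,g}:F(f)F(g)\Rightarrow F(g f)$, $\mathbf{PC}(F)$ has objects $(A,\Sigma_A)$: families ${}_XA\in F(X)$ with isomorphisms $\tau^A_f:F(f)({}_YA)\to{}_XA$ ($f:X\to Y$) such that $\tau^A_{gf}\phi_{f,g}=\tau^A_f\circ F(f)(\tau^A_g)$; morphisms are families ${}_X\rho:{}_XA\to{}_XB$ with $\tau^B_f\circ F(f)({}_Y\rho)={}_X\rho\circ\tau^A_f$. For pseudonatural $h:F\Rightarrow E$ with ${}_fh:{}_Xh\circ F(f)\Rightarrow E(f)\circ{}_Yh$, the functor $\mathbf{PC}(h)=\underline h$ sends $(A,\Sigma_A)$ to $({}_Xh({}_XA))_X$ with transition isomorphisms ${}_Xh(\tau^A_f)\circ({}_fh)^{-1}_{{}_YA}$; a modification $\rho:h\Rrightarrow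 k$ goes to $\underline\rho$ with components $({}_X\rho)_{{}_XA}$. The lift sends a tangent object $(F,T,p,0,\mathrm{add},\ell,c)$ to $\mathbf{PC}(F)$ with $(\underline T,\underline p,\underline 0,\underline{\mathrm{add}},\underline\ell,\underline c)$, $(h,\alpha)$ to $(\underline h,\underline\alpha)$ and $\rho$ to $\underline\rho$. *)

(* Defs.v *)
From Stdlib Require Import ssreflect FunctionalExtensionality ProofIrrelevance.
From Stdlib Require Fin.

Set Implicit Arguments.
Unset Strict Implicit.
Unset Printing Implicit Defensive.

Record Category := {
  ob :> Type;
  hom : ob -> ob -> Type;
  idm : forall a, hom a a;
  comp : forall a b c, hom b c -> hom a b -> hom a c;
  comp_idl : forall a b (f : hom a b), comp (idm b) f = f;
  comp_idr : forall a b (f : hom a b), comp f (idm a) = f;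
  comp_assoc : forall a b c d (h : hom c d) (g : hom b c) (f : hom a b),
      comp (comp h g) f = comp h (comp g f) }.
Arguments hom {_} _ _.
Arguments idm {_} _.
Arguments comp {_ _ _ _} _ _.
Arguments comp_idl {_ _ _} _.
Arguments comp_idr {_ _ _} _.
Arguments comp_assoc {_ _ _ _ _} _ _ _.

Notation "g ∘ f" := (comp g f) (at level 40, left associativity).

(* The identity, seen as a morphism between two propositionally equal objects;
   strictness of a 2-category or a 2-functor is used through these. *)
Definition can {D : Category} {a b : D} (e : a = b) : hom a b :=
  match e in _ = b' return hom a b' with eq_refl => idm a end.

Definition is_identity {D : Category} {a b : D} (f : hom a b) : Prop :=
  exists e : a = b, f = can e.

Record Iso (D : Category) (a b : D) := {
  fwd :> hom a b;
  bwd : hom b a;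
  bwd_fwd : bwd ∘ fwd = idm a;
  fwd_bwd : fwd ∘ bwd = idm b }.
Arguments bwd {_ _ _} _.
Arguments bwd_fwd {_ _ _} _.
Arguments fwd_bwd {_ _ _} _.

Record Functor (D E : Category) := {
  fob :> D -> E;
  fmap : forall a b, hom a b -> hom (fob a) (fob b);
  fmap_id : forall a, fmap (idm a) = idm (fob a);
  fmap_comp : forall a b c (g : hom b c) (f : hom a b),
      fmap (g ∘ f) = fmap g ∘ fmap f }.
Arguments fmap {_ _} _ {_ _} _.
Arguments fmap_id {_ _} _ _.
Arguments fmap_comp {_ _} _ {_ _ _} _ _.

Record NatTrans (D E : Category) (F G : Functor D E) := {
  nt :> forall a : D, hom (F a) (G a);
  nt_nat : forall (a b : D) (f : hom a b), nt b ∘ fmap F f = fmap G f ∘ nt a }.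
Arguments nt {_ _ _ _} _ _.
Arguments nt_nat {_ _ _ _} _ {_ _} _.

Lemma nt_eq (D E : Category) (F G : Functor D E) (s t : NatTrans F G) :
  (forall a, s a = t a) -> s = t.
Proof.
case: s t => [s sn] [t tn] /= H.
have E' : s = t by apply: functional_extensionality_dep.
by subst t; rewrite (proof_irrelevance _ sn tn).
Qed.

Lemma can_irr (D : Category) (a b : D) (e e' : a = b) : can e = can e'.
Proof. by rewrite (proof_irrelevance _ e e'). Qed.

Lemma can_loop (D : Category) (a : D) (e : a = a) : can e = idm a.
Proof. by rewrite (proof_irrelevance _ e eq_refl). Qed.

Lemma can_comp (D : Category) (a b c : D) (e' : b = c) (e : a = b) :
  can e' ∘ can e = can (eq_trans e e').
Proof. by subst c; rewrite comp_idl. Qed.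

Lemma fmap_can (D E : Category) (F : Functor D E) (a b : D) (e : a = b) :
  fmap F (can e) = can (f_equal F e).
Proof. by subst b; rewrite /= fmap_id. Qed.

Lemma functor_irr (D E : Category) (o : D -> E)
    (m : forall a b, hom a b -> hom (o a) (o b)) i1 i2 c1 c2 :
  @Build_Functor D E o m i1 c1 = @Build_Functor D E o m i2 c2.
Proof. by rewrite (proof_irrelevance _ i1 i2) (proof_irrelevance _ c1 c2). Qed.

Lemma functor_eq (D E : Category) (F G : Functor D E) (eo : forall a, F a = G a) :
  (forall a b (f : hom a b), can (eo b) ∘ fmap F f = fmap G f ∘ can (eo a)) -> F = G.
Proof.
case: F G eo => [Fo Fm Fi Fc] [Go Gm Gi Gc] /= eo H.
have E' : Fo = Go by apply: functional_extensionality.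
subst Go.
have E' : Fm = Gm.
  apply: functional_extensionality_dep => a.
  apply: functional_extensionality_dep => b.
  apply: functional_extensionality_dep => f.
  by move: (H a b f); rewrite !can_loop comp_idl comp_idr.
by subst Gm; apply: functor_irr.
Qed.

Lemma functor_eq_nat (D E : Category) (F G : Functor D E) (e : F = G) (a b : D)
    (f : hom a b) (ea : F a = G a) (eb : F b = G b) :
  can eb ∘ fmap F f = fmap G f ∘ can ea.
Proof. by subst G; rewrite !can_loop comp_idl comp_idr. Qed.

Definition FId (D : Category) : Functor D D :=
  {| fob := fun a : D => a; fmap := fun _ _ f => f;
     fmap_id := fun _ => eq_refl; fmap_comp := fun _ _ _ _ _ => eq_refl |}.

Definition FComp (D E G : Category) (K : Functor E G) (H : Functor D E) : Functor D G.
Proof.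
refine {| fob := fun a => K (H a); fmap := fun _ _ f => fmap K (fmap H f) |}.
- abstract (by move=> a; rewrite !fmap_id).
- abstract (by move=> a b c g f; rewrite !fmap_comp).
Defined.

Notation "K ∘F H" := (FComp K H) (at level 40, left associativity).

Definition nt_id (D E : Category) (F : Functor D E) : NatTrans F F.
Proof.
refine {| nt := fun a => idm (F a) |}.
abstract (by move=> a b f; rewrite comp_idl comp_idr).
Defined.

Definition nt_comp (D E : Category) (F G H : Functor D E)
    (t : NatTrans G H) (s : NatTrans F G) : NatTrans F H.
Proof.
refine {| nt := fun a => t a ∘ s a |}.
abstract (by move=> a b f; rewrite comp_assoc nt_nat -comp_assoc nt_nat comp_assoc).
Defined.

Definition FunCat (D E : Category) : Category.
Proof.
refine {| ob := Functor D E; hom := @NatTrans D E;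
          idm := @nt_id D E; comp := @nt_comp D E |}.
- abstract (by move=> a b f; apply: nt_eq => x /=; rewrite comp_idl).
- abstract (by move=> a b f; apply: nt_eq => x /=; rewrite comp_idr).
- abstract (by move=> a b c d h g f; apply: nt_eq => x /=; rewrite comp_assoc).
Defined.

Lemma nt_can (D E : Category) (F G : FunCat D E) (e : F = G) (a : D)
    (ea : fob F a = fob G a) : nt (can e) a = can ea.
Proof. by subst G; rewrite (can_loop ea). Qed.

Lemma fun_can_nat (D E : Category) (F G F' G' : Functor D E)
    (s : NatTrans F G) (s' : NatTrans F' G') (e : G = G') (e' : F = F')
    (eb : forall a, G a = G' a) (ea : forall a, F a = F' a) :
  (forall a, can (eb a) ∘ s a = s' a ∘ can (ea a)) ->
  (can (e : G = G' :> FunCat D E)) ∘ (s : hom (_ : FunCat D E) _) =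
  (s' : hom (_ : FunCat D E) _) ∘ can (e' : F = F' :> FunCat D E).
Proof.
move=> H; apply: nt_eq => a /=.
by move: (H a); rewrite -(nt_can e) -(nt_can e').
Qed.

Definition ProdCat (D E : Category) : Category.
Proof.
refine {|
  ob := (D * E)%type;
  hom := fun a b => (hom (fst a) (fst b) * hom (snd a) (snd b))%type;
  idm := fun a => (idm (fst a), idm (snd a));
  comp := fun _ _ _ g f => (fst g ∘ fst f, snd g ∘ snd f) |}.
- abstract (by move=> a b [f f'] /=; rewrite !comp_idl).
- abstract (by move=> a b [f f'] /=; rewrite !comp_idr).
- abstract (by move=> a b c d h g f /=; rewrite !comp_assoc).
Defined.

Definition FConst (D E : Category) (x : E) : Functor D E.
Proof.
refine {| fob := fun _ => x; fmap := fun _ _ _ => idm x |} => //.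
abstract (by move=> *; rewrite comp_idl).
Defined.

Definition FPair (D E1 E2 : Category) (F : Functor D E1) (G : Functor D E2) :
  Functor D (ProdCat E1 E2).
Proof.
refine {| fob := fun a => (F a, G a) : ProdCat E1 E2;
          fmap := fun a b f => (fmap F f, fmap G f) |}.
- abstract (by move=> a; rewrite !fmap_id).
- abstract (by move=> *; rewrite !fmap_comp).
Defined.

Definition FProd (D1 D2 E1 E2 : Category) (F : Functor D1 E1) (G : Functor D2 E2) :
  Functor (ProdCat D1 D2) (ProdCat E1 E2).
Proof.
refine {| fob := fun a : ProdCat D1 D2 => (F (fst a), G (snd a)) : ProdCat E1 E2;
          fmap := fun a b f => (fmap F (fst f), fmap G (snd f)) |}.
- abstract (by move=> a; rewrite /= !fmap_id).
- abstract (by move=> *; rewrite /= !fmap_comp).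
Defined.

Definition FAssoc (D E G : Category) :
  Functor (ProdCat (ProdCat D E) G) (ProdCat D (ProdCat E G)).
Proof.
by refine {| fob := fun a : ProdCat (ProdCat D E) G =>
                 (fst (fst a), (snd (fst a), snd a)) : ProdCat D (ProdCat E G);
             fmap := fun a b f => (fst (fst f), (snd (fst f), snd f)) |}.
Defined.

(* A strict 2-category is a category enriched in categories; the laws are
   equalities of functors, so they cover 1-cells and 2-cells at once. *)
Record TwoCat := {
  cell0 :> Type;
  cell1 : cell0 -> cell0 -> Category;
  id1 : forall X, cell1 X X;
  hcomp : forall X Y Z, Functor (ProdCat (cell1 Y Z) (cell1 X Y)) (cell1 X Z);
  hcomp_idl : forall X Y, hcomp X Y Y ∘F FPair (FConst _ (id1 Y)) (FId _) = FId (cell1 X Y);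
  hcomp_idr : forall X Y, hcomp X X Y ∘F FPair (FId _) (FConst _ (id1 X)) = FId (cell1 X Y);
  hcomp_assoc : forall X Y Z W,
      hcomp X Y W ∘F FProd (hcomp Y Z W) (FId (cell1 X Y)) =
      hcomp X Z W ∘F FProd (FId (cell1 Z W)) (hcomp X Y Z) ∘F FAssoc _ _ _ }.
Arguments cell1 {_} _ _.
Arguments id1 {_} _.
Arguments hcomp {_} _ _ _.
Arguments hcomp_idl {_} _ _.
Arguments hcomp_idr {_} _ _.
Arguments hcomp_assoc {_} _ _ _ _.

Definition comp1 {K : TwoCat} {X Y Z : K} (g : cell1 Y Z) (f : cell1 X Y) : cell1 X Z :=
  hcomp X Y Z (g, f).

Notation "g ⊙ f" := (comp1 g f) (at level 35, right associativity).

Definition comp2 {K : TwoCat} {X Y Z : K} {g g' : cell1 Y Z} {f f' : cell1 X Y}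
    (s : hom g g') (r : hom f f') : hom (g ⊙ f) (g' ⊙ f') :=
  @fmap _ _ (hcomp X Y Z) (g, f) (g', f') (s, r).

Definition wl {K : TwoCat} {X Y Z : K} (g : cell1 Y Z) {f f' : cell1 X Y} (r : hom f f') :
  hom (g ⊙ f) (g ⊙ f') := comp2 (idm g) r.

Definition wr {K : TwoCat} {X Y Z : K} {g g' : cell1 Y Z} (s : hom g g') (f : cell1 X Y) :
  hom (g ⊙ f) (g' ⊙ f) := comp2 s (idm f).

Section Structural.
Context {K : TwoCat} {X Y Z W : K}.

Lemma comp1_idl (f : cell1 X Y) : id1 Y ⊙ f = f.
Proof. exact (f_equal (fun F : Functor _ _ => F f) (hcomp_idl X Y)). Qed.

Lemma comp1_idr (f : cell1 X Y) : f ⊙ id1 X = f.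
Proof. exact (f_equal (fun F : Functor _ _ => F f) (hcomp_idr X Y)). Qed.

Lemma comp1_assoc (h : cell1 Z W) (g : cell1 Y Z) (f : cell1 X Y) :
  (h ⊙ g) ⊙ f = h ⊙ (g ⊙ f).
Proof.
exact (f_equal (fun F : Functor (ProdCat (ProdCat _ _) _) _ => fob F (h, g, f))
               (hcomp_assoc X Y Z W)).
Qed.

Definition lun (f : cell1 X Y) : hom (id1 Y ⊙ f) f := can (comp1_idl f).
Definition luni (f : cell1 X Y) : hom f (id1 Y ⊙ f) := can (eq_sym (comp1_idl f)).
Definition run (f : cell1 X Y) : hom (f ⊙ id1 X) f := can (comp1_idr f).
Definition runi (f : cell1 X Y) : hom f (f ⊙ id1 X) := can (eq_sym (comp1_idr f)).
Definition asc (h : cell1 Z W) (g : cell1 Y Z) (f : cell1 X Y) :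
  hom ((h ⊙ g) ⊙ f) (h ⊙ (g ⊙ f)) := can (comp1_assoc h g f).
Definition asci (h : cell1 Z W) (g : cell1 Y Z) (f : cell1 X Y) :
  hom (h ⊙ (g ⊙ f)) ((h ⊙ g) ⊙ f) := can (eq_sym (comp1_assoc h g f)).
End Structural.

Record TwoFunctor (K L : TwoCat) := {
  tf0 :> K -> L;
  tf1 : forall X Y, Functor (cell1 X Y) (cell1 (tf0 X) (tf0 Y));
  tf_id : forall X, tf1 X X (id1 X) = id1 (tf0 X);
  tf_hcomp : forall X Y Z,
      tf1 X Z ∘F hcomp X Y Z = hcomp (tf0 X) (tf0 Y) (tf0 Z) ∘F FProd (tf1 Y Z) (tf1 X Y) }.
Arguments tf1 {_ _} _ {_ _}.
Arguments tf_id {_ _} _ _.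
Arguments tf_hcomp {_ _} _ _ _ _.

Lemma tf_comp1 (K L : TwoCat) (P : TwoFunctor K L) (X Y Z : K)
    (g : cell1 Y Z) (f : cell1 X Y) : tf1 P (g ⊙ f) = tf1 P g ⊙ tf1 P f.
Proof. exact (f_equal (fun F : Functor (ProdCat _ _) _ => fob F (g, f)) (tf_hcomp P X Y Z)). Qed.

Lemma tf_comp_id (K L M : TwoCat) (Q : TwoFunctor L M) (P : TwoFunctor K L) (X : K) :
  (tf1 Q ∘F tf1 P) (id1 X) = id1 (Q (P X)).
Proof. by rewrite /= !tf_id. Qed.

Lemma tf_comp_hcomp (K L M : TwoCat) (Q : TwoFunctor L M) (P : TwoFunctor K L) (X Y Z : K) :
  (tf1 Q ∘F tf1 P) ∘F hcomp X Y Z =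
  hcomp (Q (P X)) (Q (P Y)) (Q (P Z)) ∘F FProd (tf1 Q ∘F tf1 P) (tf1 Q ∘F tf1 P).
Proof.
transitivity (tf1 Q ∘F (tf1 P ∘F hcomp X Y Z)); first exact: functor_irr.
rewrite tf_hcomp.
transitivity (tf1 Q ∘F hcomp (P X) (P Y) (P Z) ∘F FProd (tf1 P) (tf1 P));
  first exact: functor_irr.
by rewrite tf_hcomp; apply: functor_irr.
Qed.

Definition TFComp (K L M : TwoCat) (Q : TwoFunctor L M) (P : TwoFunctor K L) : TwoFunctor K M :=
  {| tf0 := fun X => Q (P X); tf1 := fun X Y => tf1 Q ∘F tf1 P;
     tf_id := tf_comp_id Q P; tf_hcomp := tf_comp_hcomp Q P |}.

Definition nt_hcomp (D E G : Category) (K K' : Functor E G) (H H' : Functor D E)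
    (t : NatTrans K K') (s : NatTrans H H') : NatTrans (K ∘F H) (K' ∘F H').
Proof.
refine {| nt := fun a => (t (H' a) ∘ fmap K (s a) : hom ((K ∘F H) a) ((K' ∘F H') a)) |}.
abstract (by move=> a b f /=;
  rewrite comp_assoc -fmap_comp (nt_nat s) fmap_comp -!comp_assoc nt_nat).
Defined.

Definition cat_hcomp (D E G : Category) :
  Functor (ProdCat (FunCat E G) (FunCat D E)) (FunCat D G).
Proof.
refine {|
  fob := fun p : ProdCat (FunCat E G) (FunCat D E) => (fst p ∘F snd p : FunCat D G);
  fmap := fun p q st => nt_hcomp (fst st) (snd st) |}.
- abstract (by move=> p; apply: nt_eq => a /=; rewrite fmap_id comp_idl).
- abstract (move=> p q r g f; apply: nt_eq => a /=;
  rewrite fmap_comp !comp_assoc; congr (_ ∘ _);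
  by rewrite -!comp_assoc nt_nat).
Defined.

Lemma FComp_idl (D E : Category) (F : Functor D E) : FId E ∘F F = F.
Proof. by case: F => *; apply: functor_irr. Qed.

Lemma FComp_idr (D E : Category) (F : Functor D E) : F ∘F FId D = F.
Proof. by case: F => *; apply: functor_irr. Qed.

Lemma FComp_assoc (D E G J : Category) (H : Functor G J) (K : Functor E G) (F : Functor D E) :
  H ∘F K ∘F F = H ∘F (K ∘F F).
Proof. exact: functor_irr. Qed.

Lemma cat_hcomp_idl (D E : Category) :
  cat_hcomp D E E ∘F FPair (FConst _ (FId E : FunCat E E)) (FId _) = FId (FunCat D E).
Proof.
unshelve eapply functor_eq; first by move=> F; exact: FComp_idl.
move=> F G s; unshelve eapply fun_can_nat => //= a.
by rewrite !comp_idl comp_idr.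
Qed.

Lemma cat_hcomp_idr (D E : Category) :
  cat_hcomp D D E ∘F FPair (FId _) (FConst _ (FId D : FunCat D D)) = FId (FunCat D E).
Proof.
unshelve eapply functor_eq; first by move=> F; exact: FComp_idr.
move=> F G s; unshelve eapply fun_can_nat => //= a.
by rewrite fmap_id comp_idl !comp_idr.
Qed.

Lemma cat_hcomp_assoc (D E G J : Category) :
  cat_hcomp D E J ∘F FProd (cat_hcomp E G J) (FId (FunCat D E)) =
  cat_hcomp D G J ∘F FProd (FId (FunCat G J)) (cat_hcomp D E G) ∘F FAssoc _ _ _.
Proof.
unshelve eapply functor_eq; first by move=> p; exact: FComp_assoc.
move=> p q s; unshelve eapply fun_can_nat => //= a.
by rewrite comp_idl comp_idr fmap_comp comp_assoc.
Qed.

Definition CatTwoCat : TwoCat :=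
  {| cell0 := Category; cell1 := FunCat; id1 := FId; hcomp := cat_hcomp;
     hcomp_idl := cat_hcomp_idl; hcomp_idr := cat_hcomp_idr; hcomp_assoc := cat_hcomp_assoc |}.

Section Whiskering.
Context {K : TwoCat}.
Implicit Types X Y Z W : K.

Lemma comp2_comp X Y Z (g g' g'' : cell1 Y Z) (f f' f'' : cell1 X Y)
    (s' : hom g' g'') (s : hom g g') (r' : hom f' f'') (r : hom f f') :
  comp2 (s' ∘ s) (r' ∘ r) = comp2 s' r' ∘ comp2 s r.
Proof. exact: (@fmap_comp _ _ (hcomp X Y Z) (g, f) (g', f') (g'', f'') (s', r') (s, r)). Qed.

Lemma comp2_id X Y Z (g : cell1 Y Z) (f : cell1 X Y) : comp2 (idm g) (idm f) = idm (g ⊙ f).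
Proof. exact: (@fmap_id _ _ (hcomp X Y Z) (g, f)). Qed.

Lemma wl_comp X Y Z (g : cell1 Y Z) (f f' f'' : cell1 X Y) (r' : hom f' f'') (r : hom f f') :
  wl g (r' ∘ r) = wl g r' ∘ wl g r.
Proof. by rewrite /wl -comp2_comp comp_idl. Qed.

Lemma wr_comp X Y Z (f : cell1 X Y) (g g' g'' : cell1 Y Z) (r' : hom g' g'') (r : hom g g') :
  wr (r' ∘ r) f = wr r' f ∘ wr r f.
Proof. by rewrite /wr -comp2_comp comp_idl. Qed.

Lemma wl_can X Y Z (g : cell1 Y Z) (f f' : cell1 X Y) (e : f = f') :
  wl g (can e) = can (f_equal (comp1 g) e).
Proof. by subst f'; rewrite /wl comp2_id. Qed.

Lemma wr_can X Y Z (g g' : cell1 Y Z) (f : cell1 X Y) (e : g = g') :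
  wr (can e) f = can (f_equal (fun h => comp1 h f) e).
Proof. by subst g'; rewrite /wr comp2_id. Qed.

Lemma wl_wr X Y Z (g g' : cell1 Y Z) (f f' : cell1 X Y) (s : hom g g') (r : hom f f') :
  wl g' r ∘ wr s f = wr s f' ∘ wl g r.
Proof. by rewrite /wl /wr -!comp2_comp !comp_idl !comp_idr. Qed.

Lemma comp2E X Y Z (g g' : cell1 Y Z) (f f' : cell1 X Y) (s : hom g g') (r : hom f f') :
  comp2 s r = wr s f' ∘ wl g r.
Proof. by rewrite /wl /wr -!comp2_comp !comp_idl !comp_idr. Qed.

Lemma asc_nat X Y Z W (h h' : cell1 Z W) (g g' : cell1 Y Z) (f f' : cell1 X Y)
    (t : hom h h') (s : hom g g') (r : hom f f') :
  asc h' g' f' ∘ comp2 (comp2 t s) r = comp2 t (comp2 s r) ∘ asc h g f.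
Proof.
exact: (@functor_eq_nat _ _ _ _ (hcomp_assoc X Y Z W) ((h, g), f) ((h', g'), f')
          ((t, s), r)).
Qed.

Lemma lun_nat X Y (f f' : cell1 X Y) (r : hom f f') : lun f' ∘ wl (id1 Y) r = r ∘ lun f.
Proof. exact: (functor_eq_nat (hcomp_idl X Y)). Qed.

Lemma run_nat X Y (f f' : cell1 X Y) (r : hom f f') : run f' ∘ wr r (id1 X) = r ∘ run f.
Proof. exact: (functor_eq_nat (hcomp_idr X Y)). Qed.

Lemma can_sym_l (D : Category) (a b : D) (e : a = b) : can (eq_sym e) ∘ can e = idm a.
Proof. by rewrite can_comp can_loop. Qed.

Lemma can_sym_r (D : Category) (a b : D) (e : a = b) : can e ∘ can (eq_sym e) = idm b.
Proof. by rewrite can_comp can_loop. Qed.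

Lemma can_move (D : Category) (a b a' b' : D) (e : a = a') (e' : b = b')
    (f : hom a b) (g : hom a' b') :
  can e' ∘ f = g ∘ can e -> can (eq_sym e') ∘ g = f ∘ can (eq_sym e).
Proof. by subst a' b'; rewrite /= !comp_idl !comp_idr. Qed.

Lemma asc_wrwr X Y Z W (h h' : cell1 Z W) (g : cell1 Y Z) (f : cell1 X Y) (t : hom h h') :
  asc h' g f ∘ wr (wr t g) f = wr t (g ⊙ f) ∘ asc h g f.
Proof. by rewrite /wr asc_nat comp2_id. Qed.

Lemma asc_wrwl X Y Z W (h : cell1 Z W) (g g' : cell1 Y Z) (f : cell1 X Y) (t : hom g g') :
  asc h g' f ∘ wr (wl h t) f = wl h (wr t f) ∘ asc h g f.
Proof. by rewrite /wr /wl asc_nat. Qed.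

Lemma asc_wl X Y Z W (h : cell1 Z W) (g : cell1 Y Z) (f f' : cell1 X Y) (t : hom f f') :
  asc h g f' ∘ wl (h ⊙ g) t = wl h (wl g t) ∘ asc h g f.
Proof. by rewrite /wl -(comp2_id h g) asc_nat. Qed.

Lemma asci_wr X Y Z W (h h' : cell1 Z W) (g : cell1 Y Z) (f : cell1 X Y) (t : hom h h') :
  asci h' g f ∘ wr t (g ⊙ f) = wr (wr t g) f ∘ asci h g f.
Proof. exact: can_move (asc_wrwr _ _ _). Qed.

Lemma asci_wlwr X Y Z W (h : cell1 Z W) (g g' : cell1 Y Z) (f : cell1 X Y) (t : hom g g') :
  asci h g' f ∘ wl h (wr t f) = wr (wl h t) f ∘ asci h g f.
Proof. exact: can_move (asc_wrwl _ _ _). Qed.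

Lemma asci_wlwl X Y Z W (h : cell1 Z W) (g : cell1 Y Z) (f f' : cell1 X Y) (t : hom f f') :
  asci h g f' ∘ wl h (wl g t) = wl (h ⊙ g) t ∘ asci h g f.
Proof. exact: can_move (asc_wl _ _ _). Qed.
End Whiskering.

Section Squares.
Context {K : TwoCat}.
Implicit Types X Y Z : K.

(* The 2-cell (β h) (g α) of the composite (g, β) (h, α). *)
Definition paste {X Y Z : K} {g : cell1 Y Z} {h : cell1 X Y}
    {t : cell1 X X} {s : cell1 Y Y} {r : cell1 Z Z}
    (b : hom (g ⊙ s) (r ⊙ g)) (a : hom (h ⊙ t) (s ⊙ h)) :
  hom ((g ⊙ h) ⊙ t) (r ⊙ (g ⊙ h)) :=
  asc r g h ∘ (wr b h ∘ (asci g s h ∘ (wl g a ∘ asc g h t))).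

(* The 2-cell (s α) (α t). *)
Definition twice {X Y : K} {h : cell1 X Y} {t : cell1 X X} {s : cell1 Y Y}
    (a : hom (h ⊙ t) (s ⊙ h)) : hom (h ⊙ (t ⊙ t)) ((s ⊙ s) ⊙ h) :=
  asci s s h ∘ (wl s a ∘ (asc s h t ∘ (wr a t ∘ asci h t t))).

Lemma paste_sq X Y Z (g : cell1 Y Z) (h : cell1 X Y)
    (t t' : cell1 X X) (s s' : cell1 Y Y) (r r' : cell1 Z Z)
    (b : hom (g ⊙ s) (r ⊙ g)) (a : hom (h ⊙ t) (s ⊙ h))
    (b' : hom (g ⊙ s') (r' ⊙ g)) (a' : hom (h ⊙ t') (s' ⊙ h))
    (x : hom t t') (y : hom s s') (z : hom r r') :
  a' ∘ wl h x = wr y h ∘ a -> b' ∘ wl g y = wr z g ∘ b ->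
  paste b' a' ∘ wl (g ⊙ h) x = wr z (g ⊙ h) ∘ paste b a.
Proof.
move=> Ha Hb; rewrite /paste !comp_assoc asc_wl.
rewrite -(comp_assoc (wl g a')) -wl_comp Ha wl_comp !comp_assoc.
rewrite -(comp_assoc (asci g s' h)) asci_wlwr !comp_assoc.
rewrite -(comp_assoc (wr b' h)) -wr_comp Hb wr_comp !comp_assoc.
by rewrite -(comp_assoc (asc r' g h)) asc_wrwr !comp_assoc.
Qed.

Lemma paste_2cell X Y Z (g g' : cell1 Y Z) (h h' : cell1 X Y)
    (t : cell1 X X) (s : cell1 Y Y) (r : cell1 Z Z)
    (b : hom (g ⊙ s) (r ⊙ g)) (a : hom (h ⊙ t) (s ⊙ h))
    (b' : hom (g' ⊙ s) (r ⊙ g')) (a' : hom (h' ⊙ t) (s ⊙ h'))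
    (v : hom g g') (u : hom h h') :
  wl s u ∘ a = a' ∘ wr u t -> wl r v ∘ b = b' ∘ wr v s ->
  wl r (comp2 v u) ∘ paste b a = paste b' a' ∘ wr (comp2 v u) t.
Proof.
move=> Ha Hb; rewrite comp2E wl_comp wr_comp /paste !comp_assoc.
rewrite -(comp_assoc (asc g' h' t)) asc_wrwr !comp_assoc asc_wrwl.
rewrite -(comp_assoc (wl r (wl g u))) -asc_wl !comp_assoc.
rewrite -(comp_assoc (wl (r ⊙ g) u)) wl_wr !comp_assoc.
rewrite -(comp_assoc (wl (g ⊙ s) u)) -asci_wlwl !comp_assoc.
rewrite -(comp_assoc (wl g (wl s u))) -wl_comp Ha wl_comp !comp_assoc.
rewrite -(comp_assoc (wl r (wr v h'))) -asc_wrwl !comp_assoc.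
rewrite -(comp_assoc (wr (wl r v) h')) -wr_comp Hb wr_comp !comp_assoc.
do 2 congr (_ ∘ _).
rewrite -(comp_assoc (wr (wr v s) h')) -asci_wr !comp_assoc.
congr (_ ∘ _).
rewrite -(comp_assoc (wl g' a')) wl_wr !comp_assoc.
by rewrite -(comp_assoc (wl g a')) -wl_comp.
Qed.

Ltac mergecan :=
  rewrite /lun /luni /run /runi /asc /asci ?wl_can ?wr_can ?can_comp ?fmap_can.

Lemma paste_can X Y Z (g : cell1 Y Z) (h : cell1 X Y)
    (t : cell1 X X) (s : cell1 Y Y) (r : cell1 Z Z)
    (e : g ⊙ s = r ⊙ g) (e' : h ⊙ t = s ⊙ h) (e'' : (g ⊙ h) ⊙ t = r ⊙ (g ⊙ h)) :
  paste (can e) (can e') = can e''.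
Proof. by rewrite /paste; mergecan; apply: can_irr. Qed.

Lemma twice_can X Y (h : cell1 X Y) (t : cell1 X X) (s : cell1 Y Y)
    (e : h ⊙ t = s ⊙ h) (e' : h ⊙ (t ⊙ t) = (s ⊙ s) ⊙ h) :
  twice (can e) = can e'.
Proof. by rewrite /twice; mergecan; apply: can_irr. Qed.

Lemma can_compA (D : Category) (a b c d : D) (x : hom a b) (e' : c = d) (e : b = c) :
  can e' ∘ (can e ∘ x) = can (eq_trans e e') ∘ x.
Proof. by rewrite -comp_assoc can_comp. Qed.

Lemma can_loopA (D : Category) (a b : D) (x : hom a b) (e : b = b) : can e ∘ x = x.
Proof. by rewrite can_loop comp_idl. Qed.

Lemma conj_can (D : Category) (a b a' b' : D) (e : a = a') (e' : b = b')
    (f : hom a b) (g : hom a' b') :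
  can e' ∘ f = g ∘ can e -> f = can (eq_sym e') ∘ (g ∘ can e).
Proof. by subst a' b'; rewrite /= !comp_idl !comp_idr. Qed.

Lemma conj_can' (D : Category) (a b a' b' : D) (e : a = a') (e' : b = b')
    (f : hom a b) (g : hom a' b') :
  can e' ∘ f = g ∘ can e -> g = can e' ∘ (f ∘ can (eq_sym e)).
Proof. by subst a' b'; rewrite /= !comp_idl !comp_idr. Qed.

Lemma twice_paste X Y Z (g : cell1 Y Z) (h : cell1 X Y)
    (t : cell1 X X) (s : cell1 Y Y) (r : cell1 Z Z)
    (b : hom (g ⊙ s) (r ⊙ g)) (a : hom (h ⊙ t) (s ⊙ h)) :
  twice (paste b a) = paste (twice b) (twice a).
Proof.
rewrite /twice /paste !(wl_comp, wr_comp).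
rewrite (conj_can' (asc_wl r g a)) (conj_can (asc_wrwr h t b)) (conj_can (asc_wrwl g t a)).
rewrite (conj_can (asc_wrwl r h b)) (conj_can (asc_wrwr s h b)) (conj_can' (asc_wl g s a)).
mergecan.
rewrite !comp_assoc !can_compA !can_comp.
rewrite (can_loopA (wr b (h ⊙ t) ∘ _)) (can_loopA (wl (g ⊙ s) a ∘ _)).
rewrite -(comp_assoc (wl (r ⊙ g) a)) wl_wr !comp_assoc.
by repeat (congr (_ ∘ _); try apply: can_irr).
Qed.

Lemma paste_assoc X Y Z W (k : cell1 Z W) (g : cell1 Y Z) (h : cell1 X Y)
    (t : cell1 X X) (s : cell1 Y Y) (r : cell1 Z Z) (q : cell1 W W)
    (c : hom (k ⊙ r) (q ⊙ k)) (b : hom (g ⊙ s) (r ⊙ g)) (a : hom (h ⊙ t) (s ⊙ h))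
    (e : (k ⊙ g) ⊙ h = k ⊙ (g ⊙ h)) :
  wl q (can e) ∘ paste (paste c b) a = paste c (paste b a) ∘ wr (can e) t.
Proof.
rewrite /paste !(wl_comp, wr_comp).
rewrite (conj_can (asc_wrwr g h c)) (conj_can (asc_wrwl k h b)) (conj_can' (asc_wl k g a)).
mergecan.
rewrite !comp_assoc !can_compA !can_comp.
by repeat (congr (_ ∘ _); try apply: can_irr).
Qed.

Lemma paste_idl X Y (h : cell1 X Y) (t : cell1 X X) (s : cell1 Y Y)
    (a : hom (h ⊙ t) (s ⊙ h)) (e : id1 Y ⊙ s = s ⊙ id1 Y) (e' : id1 Y ⊙ h = h) :
  wl s (can e') ∘ paste (can e) a = a ∘ wr (can e') t.
Proof.
rewrite /paste (conj_can (lun_nat a)); mergecan.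
rewrite !comp_assoc !can_compA !can_comp can_loopA.
by congr (_ ∘ _); apply: can_irr.
Qed.

Lemma paste_idr X Y (h : cell1 X Y) (t : cell1 X X) (s : cell1 Y Y)
    (a : hom (h ⊙ t) (s ⊙ h)) (e : id1 X ⊙ t = t ⊙ id1 X) (e' : h ⊙ id1 X = h) :
  wl s (can e') ∘ paste a (can e) = a ∘ wr (can e') t.
Proof.
rewrite /paste (conj_can (run_nat a)); mergecan.
rewrite !comp_assoc !can_compA !can_comp can_loopA.
by congr (_ ∘ _); apply: can_irr.
Qed.

Lemma id_sq X (t t' : cell1 X X) (x : hom t t')
    (e : id1 X ⊙ t = t ⊙ id1 X) (e' : id1 X ⊙ t' = t' ⊙ id1 X) :
  can e' ∘ wl (id1 X) x = wr x (id1 X) ∘ can e.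
Proof.
rewrite (conj_can (lun_nat x)) (conj_can (run_nat x)); mergecan.
rewrite !comp_assoc !can_compA !can_comp.
by repeat (congr (_ ∘ _); try apply: can_irr).
Qed.
End Squares.

(* [P], with base map [r] and projections [u], is the [n]-fold pullback power of
   [q]; with the base map included, [n = 0] gives the base itself. *)
Definition IsPower {D : Category} {x b : D} (q : hom x b) {n : nat} {P : D}
    (r : hom P b) (u : Fin.t n -> hom P x) : Prop :=
  (forall i, q ∘ u i = r) /\
  forall (Z : D) (r' : hom Z b) (u' : Fin.t n -> hom Z x), (forall i, q ∘ u' i = r') ->
    exists! w : hom Z P, r ∘ w = r' /\ forall i, u i ∘ w = u' i.

Definition IsPullback {D : Category} {P a b c : D} (u : hom P a) (v : hom P b)
    (f : hom a c) (g : hom b c) : Prop :=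
  f ∘ u = g ∘ v /\
  forall (Z : D) (u' : hom Z a) (v' : hom Z b), f ∘ u' = g ∘ v' ->
    exists! w : hom Z P, u ∘ w = u' /\ v ∘ w = v'.

Definition IsEqualizer {D : Category} {e a b : D} (k : hom e a) (f g : hom a b) : Prop :=
  f ∘ k = g ∘ k /\
  forall (Z : D) (k' : hom Z a), f ∘ k' = g ∘ k' -> exists! w : hom Z e, k ∘ w = k'.

Definition fst2 : Fin.t 2 := Fin.F1.
Definition snd2 : Fin.t 2 := Fin.FS Fin.F1.

Lemma fin2_ind (P : Fin.t 2 -> Prop) : P fst2 -> P snd2 -> forall i, P i.
Proof.
move=> H0 H1 i; apply: (Fin.caseS' i P H0) => j.
apply: (Fin.caseS' j (fun j => P (Fin.FS j)) H1) => k.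
exact (Fin.case0 (fun k => P (Fin.FS (Fin.FS k))) k).
Qed.

(* [w = ⟨v0, v1⟩], the projections of the target being [u] *)
Definition IsPair {D : Category} {P x Z : D} (u : Fin.t 2 -> hom P x)
    (v0 v1 : hom Z x) (w : hom Z P) : Prop :=
  u fst2 ∘ w = v0 /\ u snd2 ∘ w = v1.

(* [(q, add, zero)] is a commutative monoid in the slice over [b]; the products
   [P2] and [P3] in the slice are given by their projections. *)
Record IsCommMonoidOver {D : Category} {x b P2 P3 : D} (q : hom x b)
    (u2 : Fin.t 2 -> hom P2 x) (u3 : Fin.t 3 -> hom P3 x)
    (add : hom P2 x) (zero : hom b x) : Prop := {
  cm_add_over : forall i, q ∘ add = q ∘ u2 i;
  cm_zero_over : q ∘ zero = idm b;
  cm_unit : exists w : hom x P2, IsPair u2 (zero ∘ q) (idm x) w /\ add ∘ w = idm x;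
  cm_comm : exists w : hom P2 P2, IsPair u2 (u2 snd2) (u2 fst2) w /\ add ∘ w = add;
  cm_assoc : exists w01 w12 l r : hom P3 P2,
      IsPair u2 (u3 Fin.F1) (u3 (Fin.FS Fin.F1)) w01 /\
      IsPair u2 (u3 (Fin.FS Fin.F1)) (u3 (Fin.FS (Fin.FS Fin.F1))) w12 /\
      IsPair u2 (add ∘ w01) (u3 (Fin.FS (Fin.FS Fin.F1))) l /\
      IsPair u2 (u3 Fin.F1) (add ∘ w12) r /\
      add ∘ l = add ∘ r }.

Fixpoint FPow {D : Category} (T : Functor D D) (m : nat) : Functor D D :=
  match m with 0 => FId D | S m => T ∘F FPow T m end.

Fixpoint pow1 {K : TwoCat} {X : K} (T : cell1 X X) (m : nat) : cell1 X X :=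
  match m with 0 => id1 X | S m => T ⊙ pow1 T m end.

(* The pullback powers [T_n] are chosen, because [add] has domain [T_2]; [td_base n] is
   the map to the base, determined by the projections [td_pr n i] when [n > 0]. *)
Record TanData (K : TwoCat) := {
  td_ob :> K;
  td_T : cell1 td_ob td_ob;
  td_p : hom td_T (id1 td_ob);
  td_0 : hom (id1 td_ob) td_T;
  td_Tn : nat -> cell1 td_ob td_ob;
  td_base : forall n, hom (td_Tn n) (id1 td_ob);
  td_pr : forall n, Fin.t n -> hom (td_Tn n) td_T;
  td_add : hom (td_Tn 2) td_T;
  td_l : hom td_T (td_T ⊙ td_T);
  td_c : hom (td_T ⊙ td_T) (td_T ⊙ td_T) }.
Arguments td_T {_} _.
Arguments td_p {_} _.
Arguments td_0 {_} _.
Arguments td_Tn {_} _ _.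
Arguments td_base {_} _ _.
Arguments td_pr {_} _ _ _.
Arguments td_add {_} _.
Arguments td_l {_} _.
Arguments td_c {_} _.

Record IsTangentStructure (D : Category) (T : Functor D D)
    (p : NatTrans T (FId D)) (z : NatTrans (FId D) T)
    (Tn : nat -> Functor D D) (base : forall n, NatTrans (Tn n) (FId D))
    (pr : forall n, Fin.t n -> NatTrans (Tn n) T)
    (add : NatTrans (Tn 2) T) (l : NatTrans T (T ∘F T))
    (c : NatTrans (T ∘F T) (T ∘F T)) : Prop := {
  ts_power : forall (m n : nat) (A : D),
    IsPower (fmap (FPow T m) (p A)) (fmap (FPow T m) (base n A))
            (fun i => fmap (FPow T m) (pr n i A));
  ts_monoid : forall A : D,
    IsCommMonoidOver (p A) (fun i => pr 2 i A) (fun i => pr 3 i A) (add A) (z A);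

  ts_l_p : forall A : D, fmap T (p A) ∘ l A = z A ∘ p A;
  ts_l_add : forall A : D, exists w : hom (Tn 2 A) (T (Tn 2 A)),
    IsPair (fun i => fmap T (pr 2 i A)) (l A ∘ pr 2 fst2 A) (l A ∘ pr 2 snd2 A) w /\
    l A ∘ add A = fmap T (add A) ∘ w;
  ts_l_0 : forall A : D, l A ∘ z A = fmap T (z A) ∘ z A;

  ts_c_p : forall A : D, p (T A) ∘ c A = fmap T (p A);
  ts_c_add : forall A : D, exists w : hom (T (Tn 2 A)) (Tn 2 (T A)),
    IsPair (fun i => pr 2 i (T A))
      (c A ∘ fmap T (pr 2 fst2 A)) (c A ∘ fmap T (pr 2 snd2 A)) w /\
    c A ∘ fmap T (add A) = add (T A) ∘ w;
  ts_c_0 : forall A : D, c A ∘ fmap T (z A) = z (T A);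

  ts_c_c : forall A : D, c A ∘ c A = idm (T (T A));
  ts_c_l : forall A : D, c A ∘ l A = l A;
  ts_l_l : forall A : D, fmap T (l A) ∘ l A = l (T A) ∘ l A;
  ts_c_braid : forall A : D,
    c (T A) ∘ fmap T (c A) ∘ c (T A) = fmap T (c A) ∘ c (T A) ∘ fmap T (c A);
  ts_c_c_l : forall A : D, c (T A) ∘ fmap T (c A) ∘ l (T A) = fmap T (l A) ∘ c A;

  ts_lift : forall A : D, exists w : hom (Tn 2 A) (T (Tn 2 A)),
    IsPair (fun i => fmap T (pr 2 i A)) (l A ∘ pr 2 fst2 A) (z (T A) ∘ pr 2 snd2 A) w /\
    IsEqualizer (fmap T (add A) ∘ w) (fmap T (p A)) (z A ∘ p A ∘ p (T A)) }.

Definition IsTangentCategory (d : TanData CatTwoCat) : Prop :=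
  @IsTangentStructure (td_ob d) (td_T d) (td_p d) (td_0 d) (td_Tn d) (td_base d) (td_pr d)
    (td_add d) (td_l d) (td_c d).

(* The whiskerings of [p], [0], [ℓ], [c] by [T], with unitors and associators
   (which are identities) inserted. *)
Section TanWhiskers.
Context {K : TwoCat} (d : TanData K).
Let T := td_T d.

Definition td_Tp : hom (T ⊙ T) T := run T ∘ wl T (td_p d).
Definition td_pT : hom (T ⊙ T) T := lun T ∘ wr (td_p d) T.
Definition td_T0 : hom T (T ⊙ T) := wl T (td_0 d) ∘ runi T.
Definition td_0T : hom T (T ⊙ T) := wr (td_0 d) T ∘ luni T.
Definition td_Tl : hom (T ⊙ T) (T ⊙ T ⊙ T) := wl T (td_l d).
Definition td_lT : hom (T ⊙ T) (T ⊙ T ⊙ T) := asc T T T ∘ wr (td_l d) T.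
Definition td_Tc : hom (T ⊙ T ⊙ T) (T ⊙ T ⊙ T) := wl T (td_c d).
Definition td_cT : hom (T ⊙ T ⊙ T) (T ⊙ T ⊙ T) :=
  asc T T T ∘ wr (td_c d) T ∘ asci T T T.
End TanWhiskers.

Record IsTangentObject {K : TwoCat} (d : TanData K) : Prop := {
  to_power : forall n, IsPower (td_p d) (td_base d n) (td_pr d n);
  to_power_pres : forall m n : nat, let Tm := pow1 (td_T d) m in
    IsPower (wl Tm (td_p d)) (wl Tm (td_base d n)) (fun i => wl Tm (td_pr d n i));
  to_power_pointwise : forall (n : nat) (X' : K) (f : cell1 X' d),
    IsPower (wr (td_p d) f) (wr (td_base d n) f) (fun i => wr (td_pr d n i) f);
  to_monoid : IsCommMonoidOver (td_p d) (td_pr d 2) (td_pr d 3) (td_add d) (td_0 d);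

  to_l_p : td_Tp d ∘ td_l d = td_0 d ∘ td_p d;
  to_l_add : exists w : hom (td_Tn d 2) (td_T d ⊙ td_Tn d 2),
    IsPair (fun i => wl (td_T d) (td_pr d 2 i))
      (td_l d ∘ td_pr d 2 fst2) (td_l d ∘ td_pr d 2 snd2) w /\
    td_l d ∘ td_add d = wl (td_T d) (td_add d) ∘ w;
  to_l_0 : td_l d ∘ td_0 d = td_T0 d ∘ td_0 d;

  to_c_p : td_pT d ∘ td_c d = td_Tp d;
  to_c_add : exists w : hom (td_T d ⊙ td_Tn d 2) (td_Tn d 2 ⊙ td_T d),
    IsPair (fun i => wr (td_pr d 2 i) (td_T d))
      (td_c d ∘ wl (td_T d) (td_pr d 2 fst2)) (td_c d ∘ wl (td_T d) (td_pr d 2 snd2)) w /\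
    td_c d ∘ wl (td_T d) (td_add d) = wr (td_add d) (td_T d) ∘ w;
  to_c_0 : td_c d ∘ td_T0 d = td_0T d;

  to_c_c : td_c d ∘ td_c d = idm (td_T d ⊙ td_T d);
  to_c_l : td_c d ∘ td_l d = td_l d;
  to_l_l : td_Tl d ∘ td_l d = td_lT d ∘ td_l d;
  to_c_braid : td_cT d ∘ td_Tc d ∘ td_cT d = td_Tc d ∘ td_cT d ∘ td_Tc d;
  to_c_c_l : td_cT d ∘ td_Tc d ∘ td_lT d = td_Tl d ∘ td_c d;

  to_lift : exists w : hom (td_Tn d 2) (td_T d ⊙ td_Tn d 2),
    IsPair (fun i => wl (td_T d) (td_pr d 2 i))
      (td_l d ∘ td_pr d 2 fst2) (td_0T d ∘ td_pr d 2 snd2) w /\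
    let xi := wl (td_T d) (td_add d) ∘ w in
    IsPullback xi (td_p d ∘ td_pr d 2 fst2) (td_Tp d) (td_0 d) /\
    forall (X' : K) (f : cell1 X' d),
      IsPullback (wr xi f) (wr (td_p d ∘ td_pr d 2 fst2) f) (wr (td_Tp d) f) (wr (td_0 d) f) }.

Record IsTangentMorphism {K : TwoCat} (X Y : TanData K) (h : cell1 X Y)
    (a : hom (h ⊙ td_T X) (td_T Y ⊙ h)) : Prop := {
  tm_p : lun h ∘ wr (td_p Y) h ∘ a = run h ∘ wl h (td_p X);
  tm_0 : a ∘ (wl h (td_0 X) ∘ runi h) = wr (td_0 Y) h ∘ luni h;
  tm_add : exists a2 : hom (h ⊙ td_Tn X 2) (td_Tn Y 2 ⊙ h),
    IsPair (fun i => wr (td_pr Y 2 i) h)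
      (a ∘ wl h (td_pr X 2 fst2)) (a ∘ wl h (td_pr X 2 snd2)) a2 /\
    a ∘ wl h (td_add X) = wr (td_add Y) h ∘ a2;
  tm_l : wr (td_l Y) h ∘ a = twice a ∘ wl h (td_l X);
  tm_c : wr (td_c Y) h ∘ twice a = twice a ∘ wl h (td_c X) }.

Record TanMor {K : TwoCat} (X Y : TanData K) := {
  tm_1 : cell1 X Y;
  tm_2 : hom (tm_1 ⊙ td_T X) (td_T Y ⊙ tm_1);
  tm_ax : IsTangentMorphism tm_2 }.
Arguments tm_1 {_ _ _} _.
Arguments tm_2 {_ _ _} _.
Arguments tm_ax {_ _ _} _.

Section TanMor.
Context {K : TwoCat}.
Implicit Types X Y Z : TanData K.

Lemma is_tangent_morphismE X Y (h : cell1 X Y) (a : hom (h ⊙ td_T X) (td_T Y ⊙ h))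
    (e : h ⊙ id1 X = id1 Y ⊙ h) :
  IsTangentMorphism a <->
  (can e ∘ wl h (td_p X) = wr (td_p Y) h ∘ a /\
   a ∘ wl h (td_0 X) = wr (td_0 Y) h ∘ can e /\
   (exists a2 : hom (h ⊙ td_Tn X 2) (td_Tn Y 2 ⊙ h),
      (forall i, a ∘ wl h (td_pr X 2 i) = wr (td_pr Y 2 i) h ∘ a2) /\
      a ∘ wl h (td_add X) = wr (td_add Y) h ∘ a2) /\
   twice a ∘ wl h (td_l X) = wr (td_l Y) h ∘ a /\
   twice a ∘ wl h (td_c X) = wr (td_c Y) h ∘ twice a).
Proof.
have He : e = eq_trans (comp1_idr h) (eq_sym (comp1_idl h)) by exact: proof_irrelevance.
have Hc : can e = luni h ∘ run h by rewrite He -can_comp.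
have Hc' : can e ∘ runi h = luni h by rewrite Hc comp_assoc can_sym_r comp_idr.
have Hl : lun h ∘ can e = run h by rewrite Hc -comp_assoc can_sym_r comp_idl.
split.
- case=> Hp H0 [a2 [[H1 H2] H3]] Hl' Hcc; split; [|split; [|split]] => //.
  + rewrite Hc comp_assoc -Hp -!comp_assoc.
    by rewrite /luni /lun can_sym_l comp_idl.
  + rewrite -[LHS]comp_idr -(can_sym_l (comp1_idr h)) -comp_assoc.
    rewrite (comp_assoc a) H0 comp_assoc; congr (_ ∘ _).
    by rewrite Hc.
  + by exists a2; split=> //; apply: fin2_ind.
- case=> [Hp [H0 [[a2 [H12 H3]] [Hl' Hcc]]]]; split=> //.
  + by rewrite comp_assoc -Hp -comp_assoc Hl.
  + by rewrite -comp_assoc H0 comp_assoc Hc'.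
  + by exists a2; split.
Qed.

Lemma tan_mor_id_ax X (e : id1 X ⊙ td_T X = td_T X ⊙ id1 X) :
  IsTangentMorphism (can e).
Proof.
apply/(is_tangent_morphismE _ eq_refl).
have e2 : id1 X ⊙ (td_T X ⊙ td_T X) = (td_T X ⊙ td_T X) ⊙ id1 X
  by rewrite comp1_idl comp1_idr.
have en n : id1 X ⊙ td_Tn X n = td_Tn X n ⊙ id1 X by rewrite comp1_idl comp1_idr.
rewrite !(twice_can e e2).
split; first exact: id_sq.
split; first exact: id_sq.
split; last by split; exact: id_sq.
by exists (can (en 2)); split=> [i|]; exact: id_sq.
Qed.

Definition tan_id X : TanMor X X :=
  {| tm_1 := id1 X; tm_ax := tan_mor_id_ax (eq_trans (comp1_idl _) (eq_sym (comp1_idr _))) |}.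

Lemma tan_mor_comp_ax X Y Z (g : TanMor Y Z) (h : TanMor X Y) :
  IsTangentMorphism (paste (tm_2 g) (tm_2 h)).
Proof.
have eh : tm_1 h ⊙ id1 X = id1 Y ⊙ tm_1 h by rewrite comp1_idl comp1_idr.
have eg : tm_1 g ⊙ id1 Y = id1 Z ⊙ tm_1 g by rewrite comp1_idl comp1_idr.
have egh : (tm_1 g ⊙ tm_1 h) ⊙ id1 X = id1 Z ⊙ (tm_1 g ⊙ tm_1 h)
  by rewrite comp1_idl comp1_idr.
have /(is_tangent_morphismE _ eh) [hp [h0 [[h2 [hpr hadd]] [hl hc]]]] := tm_ax h.
have /(is_tangent_morphismE _ eg) [gp [g0 [[g2 [gpr gadd]] [gl gc]]]] := tm_ax g.
apply/(is_tangent_morphismE _ egh).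
rewrite twice_paste -(paste_can eg eh egh).
split; first exact: (paste_sq hp gp).
split; first exact: (paste_sq h0 g0).
split; last by split; [exact: (paste_sq hl gl) | exact: (paste_sq hc gc)].
exists (paste g2 h2); split=> [i|]; first exact: (paste_sq (hpr i) (gpr i)).
exact: (paste_sq hadd gadd).
Qed.

Definition tan_comp X Y Z (g : TanMor Y Z) (h : TanMor X Y) : TanMor X Z :=
  {| tm_1 := tm_1 g ⊙ tm_1 h; tm_ax := tan_mor_comp_ax g h |}.

Lemma tan_mor_eq X Y (f g : TanMor X Y) (e : tm_1 f = tm_1 g) :
  wl (td_T Y) (can e) ∘ tm_2 f = tm_2 g ∘ wr (can e) (td_T X) -> f = g.
Proof.
case: f g e => [f a fax] [g b gax] /= e; subst g.
rewrite /= /wl /wr !comp2_id comp_idl comp_idr => E; subst b.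
by rewrite (proof_irrelevance _ fax gax).
Qed.

Definition TanCell X Y (f g : TanMor X Y) :=
  { r : hom (tm_1 f) (tm_1 g) |
    wl (td_T Y) r ∘ tm_2 f = tm_2 g ∘ wr r (td_T X) }.

Lemma tan_cell_eq X Y (f g : TanMor X Y) (r s : TanCell f g) :
  proj1_sig r = proj1_sig s -> r = s.
Proof.
case: r s => [r Hr] [s Hs] /= E; subst s.
by rewrite (proof_irrelevance _ Hr Hs).
Qed.

Definition tan_cell_id X Y (f : TanMor X Y) : TanCell f f.
Proof. by exists (idm (tm_1 f)); rewrite /wl /wr !comp2_id comp_idl comp_idr. Defined.

Definition tan_cell_comp X Y (f g h : TanMor X Y) (s : TanCell g h) (r : TanCell f g) :
  TanCell f h.
Proof.
exists (proj1_sig s ∘ proj1_sig r).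
abstract (by rewrite wl_comp wr_comp comp_assoc (proj2_sig r) -!comp_assoc (proj2_sig s)).
Defined.

Definition TanHom X Y : Category.
Proof.
refine {| ob := TanMor X Y; hom := @TanCell X Y;
          idm := @tan_cell_id X Y; comp := @tan_cell_comp X Y |}.
- abstract (by move=> f g r; apply: tan_cell_eq; rewrite /= comp_idl).
- abstract (by move=> f g r; apply: tan_cell_eq; rewrite /= comp_idr).
- abstract (by move=> *; apply: tan_cell_eq; rewrite /= comp_assoc).
Defined.

Lemma tan_can_nat X Y (f g f' g' : TanMor X Y) (r : TanCell f g) (r' : TanCell f' g')
    (e : g = g') (e' : f = f') :
  (forall (eb : tm_1 g = tm_1 g') (ea : tm_1 f = tm_1 f'),
     can eb ∘ proj1_sig r = proj1_sig r' ∘ can ea) ->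
  can (e : g = g' :> TanHom X Y) ∘ (r : hom (_ : TanHom X Y) _) =
  (r' : hom (_ : TanHom X Y) _) ∘ can (e' : f = f' :> TanHom X Y).
Proof.
subst f' g' => H; apply: tan_cell_eq; exact: (H eq_refl eq_refl).
Qed.

Definition tan_cell_hcomp X Y Z (g g' : TanMor Y Z) (f f' : TanMor X Y)
    (s : TanCell g g') (r : TanCell f f') : TanCell (tan_comp g f) (tan_comp g' f').
Proof.
exists (comp2 (proj1_sig s) (proj1_sig r)).
abstract (exact: paste_2cell (proj2_sig r) (proj2_sig s)).
Defined.

Definition tan_hcomp X Y Z : Functor (ProdCat (TanHom Y Z) (TanHom X Y)) (TanHom X Z).
Proof.
refine {| fob := fun p : ProdCat (TanHom Y Z) (TanHom X Y) =>
                 tan_comp (fst p) (snd p) : TanHom X Z;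
          fmap := fun p q sr => tan_cell_hcomp (fst sr) (snd sr) |}.
- abstract (by move=> p; apply: tan_cell_eq; exact: comp2_id).
- abstract (by move=> *; apply: tan_cell_eq; exact: comp2_comp).
Defined.
End TanMor.

Section TanLaws.
Context {K : TwoCat}.
Implicit Types X Y Z W : TanData K.

Lemma tan_hcomp_idl X Y :
  tan_hcomp X Y Y ∘F FPair (FConst _ (tan_id Y : TanHom Y Y)) (FId _) = FId (TanHom X Y).
Proof.
unshelve eapply functor_eq.
- move=> f; change (tan_comp (tan_id Y) f = f).
  by refine (@tan_mor_eq _ _ _ (tan_comp (tan_id Y) f) f (comp1_idl (tm_1 f)) _);
    exact: paste_idl.
- move=> f g r; eapply tan_can_nat => eb ea.
  exact (@functor_eq_nat _ _ _ _ (@hcomp_idl K X Y) (tm_1 f) (tm_1 g) (proj1_sig r) ea eb).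
Qed.

Lemma tan_hcomp_idr X Y :
  tan_hcomp X X Y ∘F FPair (FId _) (FConst _ (tan_id X : TanHom X X)) = FId (TanHom X Y).
Proof.
unshelve eapply functor_eq.
- move=> f; change (tan_comp f (tan_id X) = f).
  by refine (@tan_mor_eq _ _ _ (tan_comp f (tan_id X)) f (comp1_idr (tm_1 f)) _);
    exact: paste_idr.
- move=> f g r; eapply tan_can_nat => eb ea.
  exact (@functor_eq_nat _ _ _ _ (@hcomp_idr K X Y) (tm_1 f) (tm_1 g) (proj1_sig r) ea eb).
Qed.

Lemma tan_hcomp_assoc X Y Z W :
  tan_hcomp X Y W ∘F FProd (tan_hcomp Y Z W) (FId (TanHom X Y)) =
  tan_hcomp X Z W ∘F FProd (FId (TanHom Z W)) (tan_hcomp X Y Z) ∘F FAssoc _ _ _.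
Proof.
unshelve eapply functor_eq.
- move=> [[k g] h].
  change (tan_comp (tan_comp k g) h = tan_comp k (tan_comp g h)).
  refine (@tan_mor_eq _ _ _ (tan_comp (tan_comp k g) h) (tan_comp k (tan_comp g h))
            (comp1_assoc (tm_1 k) (tm_1 g) (tm_1 h)) _).
  exact: paste_assoc.
- move=> [[k g] h] [[k' g'] h'] [[t s] r]; eapply tan_can_nat => eb ea.
  exact (@functor_eq_nat _ _ _ _ (@hcomp_assoc K X Y Z W)
    (tm_1 k, tm_1 g, tm_1 h) (tm_1 k', tm_1 g', tm_1 h')
    (proj1_sig t, proj1_sig s, proj1_sig r) ea eb).
Qed.
End TanLaws.

(* The objects form a type [O], so that one construction serves for tangent objects
   and for tangent categories. *)
Definition TanTwoCat (K : TwoCat) (O : Type) (d : O -> TanData K) : TwoCat :=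
  {| cell0 := O; cell1 := fun X Y => TanHom (d X) (d Y);
     id1 := fun X => tan_id (d X);
     hcomp := fun X Y Z => tan_hcomp (d X) (d Y) (d Z);
     hcomp_idl := fun X Y => tan_hcomp_idl (d X) (d Y);
     hcomp_idr := fun X Y => tan_hcomp_idr (d X) (d Y);
     hcomp_assoc := fun X Y Z W => tan_hcomp_assoc (d X) (d Y) (d Z) (d W) |}.

Definition tan_forget1 (K : TwoCat) (X Y : TanData K) : Functor (TanHom X Y) (cell1 X Y) :=
  {| fob := fun f : TanHom X Y => tm_1 f; fmap := fun f g r => proj1_sig r;
     fmap_id := fun _ => eq_refl; fmap_comp := fun _ _ _ _ _ => eq_refl |}.

Definition TanForget (K : TwoCat) (O : Type) (d : O -> TanData K) :
  TwoFunctor (TanTwoCat d) K.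
Proof.
refine {| tf0 := fun X : TanTwoCat d => td_ob (d X);
          tf1 := fun X Y => tan_forget1 (d X) (d Y) |}.
- abstract (done).
- abstract (by move=> X Y Z; apply: functor_irr).
Defined.

Definition Tan (K : TwoCat) : TwoCat :=
  @TanTwoCat K {d : TanData K | IsTangentObject d} (fun d => proj1_sig d).

(* 1-cells and 2-cells are those of [Tan CatTwoCat]; the objects are the tangent
   categories, whose axioms are stated objectwise. *)
Definition TanCat : TwoCat :=
  @TanTwoCat CatTwoCat {d : TanData CatTwoCat | IsTangentCategory d} (fun d => proj1_sig d).

Definition Forget_Tan (K : TwoCat) : TwoFunctor (Tan K) K := TanForget (fun d => proj1_sig d).

Definition Forget_TanCat : TwoFunctor TanCat CatTwoCat := TanForget (fun d => proj1_sig d).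

Definition tan_data (K : TwoCat) (X : Tan K) : TanData K := proj1_sig X.

Definition tancat_data (D : TanCat) : TanData CatTwoCat := proj1_sig D.

Lemma iso_eq (D : Category) (a b : D) (i j : Iso a b) : fwd i = fwd j -> i = j.
Proof.
case: i j => [f g l r] [f' g' l' r'] /= E; subst f'.
have E : g = g' by rewrite -(comp_idr g) -r' -comp_assoc l comp_idl.
by subst g'; rewrite (proof_irrelevance _ l l') (proof_irrelevance _ r r').
Qed.

Definition iso_id (D : Category) (a : D) : Iso a a :=
  {| fwd := idm a; bwd := idm a; bwd_fwd := comp_idl _; fwd_bwd := comp_idl _ |}.

Definition iso_inv (D : Category) (a b : D) (i : Iso a b) : Iso b a :=
  {| fwd := bwd i; bwd := fwd i; bwd_fwd := fwd_bwd i; fwd_bwd := bwd_fwd i |}.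

Definition iso_comp (D : Category) (a b c : D) (j : Iso b c) (i : Iso a b) : Iso a c.
Proof.
refine {| fwd := fwd j ∘ fwd i; bwd := bwd i ∘ bwd j |}.
- abstract (by rewrite comp_assoc -(comp_assoc (bwd j)) bwd_fwd comp_idl bwd_fwd).
- abstract (by rewrite comp_assoc -(comp_assoc (fwd i)) fwd_bwd comp_idl fwd_bwd).
Defined.

Definition fmap_iso (D E : Category) (F : Functor D E) (a b : D) (i : Iso a b) :
  Iso (F a) (F b).
Proof.
refine {| fwd := fmap F (fwd i); bwd := fmap F (bwd i) |}.
- abstract (by rewrite -fmap_comp bwd_fwd fmap_id).
- abstract (by rewrite -fmap_comp fwd_bwd fmap_id).
Defined.

Lemma iso_swap (D : Category) (a b c d : D) (i : Iso a b) (j : Iso c d)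
    (x : hom a c) (y : hom b d) : fwd j ∘ x = y ∘ fwd i -> bwd j ∘ y = x ∘ bwd i.
Proof.
move=> H; rewrite -(comp_idr y) -(fwd_bwd i) -(comp_assoc y) -H.
by rewrite -!comp_assoc bwd_fwd comp_idl.
Qed.

Lemma is_identity_comp (D : Category) (a b c : D) (g : hom b c) (f : hom a b) :
  is_identity g -> is_identity f -> is_identity (g ∘ f).
Proof. by move=> [e' ->] [e ->]; exists (eq_trans e e'); rewrite can_comp. Qed.

Lemma is_identity_fmap (D E : Category) (F : Functor D E) (a b : D) (f : hom a b) :
  is_identity f -> is_identity (fmap F f).
Proof. by move=> [e ->]; exists (f_equal F e); rewrite fmap_can. Qed.

(* Normalized pseudofunctors [C^op -> Cat]: identities are preserved strictly and
   the compositors involving an identity are identities. *)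
Record PseudoFunctor (C : Category) := {
  pf_ob :> C -> Category;
  pf_map : forall X Y : C, hom X Y -> Functor (pf_ob Y) (pf_ob X);
  pf_id : forall X : C, pf_map (idm X) = FId (pf_ob X);
  pf_phi : forall (X Y Z : C) (f : hom X Y) (g : hom Y Z) (A : pf_ob Z),
      Iso (pf_map f (pf_map g A)) (pf_map (g ∘ f) A);
  pf_phi_nat : forall (X Y Z : C) (f : hom X Y) (g : hom Y Z) (A B : pf_ob Z) (u : hom A B),
      pf_phi f g B ∘ fmap (pf_map f) (fmap (pf_map g) u) =
      fmap (pf_map (g ∘ f)) u ∘ pf_phi f g A;
  pf_phi_assoc : forall (X Y Z W : C) (f : hom X Y) (g : hom Y Z) (k : hom Z W) (A : pf_ob W),
      can (f_equal (fun h => pf_map h A) (comp_assoc k g f)) ∘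
        (pf_phi f (k ∘ g) A ∘ fmap (pf_map f) (pf_phi g k A)) =
      pf_phi (g ∘ f) k A ∘ pf_phi f g (pf_map k A);
  pf_phi_idl : forall (X Y : C) (f : hom X Y) (A : pf_ob Y),
      is_identity (pf_phi f (idm Y) A);
  pf_phi_idr : forall (X Y : C) (f : hom X Y) (A : pf_ob Y),
      is_identity (pf_phi (idm X) f A) }.
Arguments pf_map {_} _ {_ _} _.
Arguments pf_phi {_} _ {_ _ _} _ _ _.

Record PseudoNat (C : Category) (F E : PseudoFunctor C) := {
  pn_fun : forall X : C, Functor (F X) (E X);
  pn_iso : forall (X Y : C) (f : hom X Y) (A : F Y),
      Iso (pn_fun X (pf_map F f A)) (pf_map E f (pn_fun Y A));
  pn_iso_nat : forall (X Y : C) (f : hom X Y) (A B : F Y) (u : hom A B),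
      pn_iso f B ∘ fmap (pn_fun X) (fmap (pf_map F f) u) =
      fmap (pf_map E f) (fmap (pn_fun Y) u) ∘ pn_iso f A;
  pn_iso_comp : forall (X Y Z : C) (f : hom X Y) (g : hom Y Z) (A : F Z),
      pn_iso (g ∘ f) A ∘ fmap (pn_fun X) (pf_phi F f g A) =
      pf_phi E f g (pn_fun Z A) ∘ (fmap (pf_map E f) (pn_iso g A) ∘ pn_iso f (pf_map F g A));
  pn_iso_id : forall (X : C) (A : F X), is_identity (pn_iso (idm X) A) }.
Arguments pn_fun {_ _ _} _ _.
Arguments pn_iso {_ _ _} _ {_ _} _ _.
Arguments pn_iso_nat {_ _ _} _ {_ _} _ {_ _} _.
Arguments pn_iso_comp {_ _ _} _ {_ _ _} _ _ _.
Arguments pn_iso_id {_ _ _} _ {_} _.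

Record Modification (C : Category) (F E : PseudoFunctor C) (h k : PseudoNat F E) := {
  md_nt : forall X : C, NatTrans (pn_fun h X) (pn_fun k X);
  md_iso : forall (X Y : C) (f : hom X Y) (A : F Y),
      pn_iso k f A ∘ md_nt X (pf_map F f A) =
      fmap (pf_map E f) (md_nt Y A) ∘ pn_iso h f A }.
Arguments md_nt {_ _ _ _ _} _ _.
Arguments md_iso {_ _ _ _ _} _ {_ _} _ _.

Section Bicat.
Context {C : Category}.
Implicit Types F E G H : PseudoFunctor C.

Lemma md_eq F E (h k : PseudoNat F E) (s t : Modification h k) :
  (forall X A, md_nt s X A = md_nt t X A) -> s = t.
Proof.
case: s t => [s sn] [t tn] /= H.
have E' : s = t.
  by apply: functional_extensionality_dep => X; apply: nt_eq => A; apply: H.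
by subst t; rewrite (proof_irrelevance _ sn tn).
Qed.

Lemma pn_eq F E (h k : PseudoNat F E) (eo : forall X, pn_fun h X = pn_fun k X) :
  (forall (X Y : C) (f : hom X Y) (A : F Y)
     (e1 : pn_fun h X (pf_map F f A) = pn_fun k X (pf_map F f A))
     (e2 : pf_map E f (pn_fun h Y A) = pf_map E f (pn_fun k Y A)),
     can e2 ∘ pn_iso h f A = pn_iso k f A ∘ can e1) -> h = k.
Proof.
case: h k eo => [h hi hn hc hu] [k ki kn kc ku] /= eo H.
have E' : h = k by apply: functional_extensionality_dep.
subst k.
have E' : hi = ki.
  apply: functional_extensionality_dep => X.
  apply: functional_extensionality_dep => Y.
  apply: functional_extensionality_dep => f.
  apply: functional_extensionality_dep => A.
  by apply: iso_eq; move: (H X Y f A eq_refl eq_refl); rewrite /= comp_idl comp_idr.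
subst ki.
by rewrite (proof_irrelevance _ hn kn) (proof_irrelevance _ hc kc) (proof_irrelevance _ hu ku).
Qed.

Definition md_id F E (h : PseudoNat F E) : Modification h h.
Proof.
refine {| md_nt := fun X => nt_id (pn_fun h X) |}.
abstract (by move=> X Y f A /=; rewrite fmap_id comp_idl comp_idr).
Defined.

Definition md_comp F E (h k l : PseudoNat F E) (t : Modification k l) (s : Modification h k) :
  Modification h l.
Proof.
refine {| md_nt := fun X => nt_comp (md_nt t X) (md_nt s X) |}.
abstract (move=> X Y f A /=;
  by rewrite fmap_comp comp_assoc -md_iso -!comp_assoc md_iso).
Defined.

Definition PNCat F E : Category.
Proof.
refine {| ob := PseudoNat F E; hom := @Modification C F E;
          idm := @md_id F E; comp := @md_comp F E |}.
- abstract (by move=> h k s; apply: md_eq => X A /=; rewrite comp_idl).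
- abstract (by move=> h k s; apply: md_eq => X A /=; rewrite comp_idr).
- abstract (by move=> a b c d u t s; apply: md_eq => X A /=; rewrite comp_assoc).
Defined.

Lemma md_can F E (h k : PNCat F E) (e : h = k) (X : C) (A : F X)
    (ea : pn_fun h X A = pn_fun k X A) : md_nt (can e) X A = can ea.
Proof. by subst k; rewrite (can_loop ea). Qed.

Lemma md_can_nat F E (h k h' k' : PseudoNat F E)
    (s : Modification h k) (s' : Modification h' k') (e : k = k') (e' : h = h')
    (eb : forall X A, pn_fun k X A = pn_fun k' X A)
    (ea : forall X A, pn_fun h X A = pn_fun h' X A) :
  (forall X A, can (eb X A) ∘ md_nt s X A = md_nt s' X A ∘ can (ea X A)) ->
  can (e : k = k' :> PNCat F E) ∘ (s : hom (_ : PNCat F E) _) =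
  (s' : hom (_ : PNCat F E) _) ∘ can (e' : h = h' :> PNCat F E).
Proof.
by move=> H; apply: md_eq => X A /=; move: (H X A); rewrite -(md_can e) -(md_can e').
Qed.

Definition pn_id F : PseudoNat F F.
Proof.
refine {| pn_fun := fun X => FId (F X); pn_iso := fun X Y f A => iso_id (pf_map F f A) |}.
- abstract (by move=> X Y f A B u /=; rewrite comp_idl comp_idr).
- abstract (by move=> X Y Z f g A /=; rewrite fmap_id !comp_idl comp_idr).
- abstract (by move=> X A; exists eq_refl).
Defined.

Definition pn_comp F E G (k : PseudoNat E G) (h : PseudoNat F E) : PseudoNat F G.
Proof.
refine {| pn_fun := fun X => pn_fun k X ∘F pn_fun h X;
          pn_iso := fun X Y f A =>
            (iso_comp (pn_iso k f (pn_fun h Y A)) (fmap_iso (pn_fun k X) (pn_iso h f A)) :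
               Iso ((pn_fun k X ∘F pn_fun h X) _)
                   (pf_map G f ((pn_fun k Y ∘F pn_fun h Y) A))) |}.
- abstract (move=> X Y f A B u /=;
  by rewrite comp_assoc -fmap_comp pn_iso_nat fmap_comp -!comp_assoc pn_iso_nat).
- abstract (move=> X Y Z f g A /=;
  rewrite comp_assoc -fmap_comp pn_iso_comp !fmap_comp -!comp_assoc pn_iso_comp;
  rewrite !comp_assoc; congr (_ ∘ (_ ∘ _));
  by rewrite -!comp_assoc pn_iso_nat).
- abstract (move=> X A; apply: is_identity_comp; first exact: pn_iso_id;
  exact: is_identity_fmap (pn_iso_id h A)).
Defined.

Definition md_hcomp F E G (k k' : PseudoNat E G) (h h' : PseudoNat F E)
    (t : Modification k k') (s : Modification h h') :
  Modification (pn_comp k h) (pn_comp k' h').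
Proof.
refine {| md_nt := fun X =>
            (nt_hcomp (md_nt t X) (md_nt s X) :
               NatTrans (pn_fun (pn_comp k h) X) (pn_fun (pn_comp k' h') X)) |}.
abstract (move=> X Y f A /=;
  rewrite comp_assoc -(comp_assoc (fmap (pn_fun k' X) _)) -(nt_nat (md_nt t X)) comp_assoc;
  rewrite -fmap_comp md_iso fmap_comp -!comp_assoc md_iso fmap_comp;
  by rewrite (comp_assoc _ (pn_iso k f _)) pn_iso_nat -!comp_assoc).
Defined.

Definition pn_hcomp F E G : Functor (ProdCat (PNCat E G) (PNCat F E)) (PNCat F G).
Proof.
refine {| fob := fun p : ProdCat (PNCat E G) (PNCat F E) => pn_comp (fst p) (snd p) : PNCat F G;
          fmap := fun p q ts => md_hcomp (fst ts) (snd ts) |}.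
- abstract (by move=> p; apply: md_eq => X A /=; rewrite fmap_id comp_idl).
- abstract (move=> p q r t s; apply: md_eq => X A /=;
  rewrite fmap_comp !comp_assoc; congr (_ ∘ _);
  by rewrite -!comp_assoc nt_nat).
Defined.

Lemma pn_comp_idl F E (h : PseudoNat F E) : pn_comp (pn_id E) h = h.
Proof.
unshelve eapply pn_eq; first by move=> X; exact: FComp_idl.
by move=> X Y f A e1 e2 /=; rewrite !can_loop !comp_idl comp_idr.
Qed.

Lemma pn_comp_idr F E (h : PseudoNat F E) : pn_comp h (pn_id F) = h.
Proof.
unshelve eapply pn_eq; first by move=> X; exact: FComp_idr.
by move=> X Y f A e1 e2 /=; rewrite !can_loop fmap_id !comp_idr comp_idl.
Qed.

Lemma pn_comp_assoc F E G H (l : PseudoNat G H) (k : PseudoNat E G) (h : PseudoNat F E) :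
  pn_comp (pn_comp l k) h = pn_comp l (pn_comp k h).
Proof.
unshelve eapply pn_eq; first by move=> X; exact: FComp_assoc.
move=> X Y f A e1 e2 /=.
by rewrite (can_loop e1) (can_loop e2) comp_idl comp_idr fmap_comp comp_assoc.
Qed.

Lemma pn_hcomp_idl F E :
  pn_hcomp F E E ∘F FPair (FConst _ (pn_id E : PNCat E E)) (FId _) = FId (PNCat F E).
Proof.
unshelve eapply functor_eq; first by move=> h; exact: pn_comp_idl.
move=> h k s; unshelve eapply md_can_nat => //= X A.
by rewrite !comp_idl comp_idr.
Qed.

Lemma pn_hcomp_idr F E :
  pn_hcomp F F E ∘F FPair (FId _) (FConst _ (pn_id F : PNCat F F)) = FId (PNCat F E).
Proof.
unshelve eapply functor_eq; first by move=> h; exact: pn_comp_idr.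
move=> h k s; unshelve eapply md_can_nat => //= X A.
by rewrite fmap_id comp_idl !comp_idr.
Qed.

Lemma pn_hcomp_assoc F E G H :
  pn_hcomp F E H ∘F FProd (pn_hcomp E G H) (FId (PNCat F E)) =
  pn_hcomp F G H ∘F FProd (FId (PNCat G H)) (pn_hcomp F E G) ∘F FAssoc _ _ _.
Proof.
unshelve eapply functor_eq; first by move=> p; exact: pn_comp_assoc.
move=> p q s; unshelve eapply md_can_nat => //= X A.
by rewrite comp_idl comp_idr fmap_comp comp_assoc.
Qed.
End Bicat.

Definition Bicat (C : Category) : TwoCat :=
  {| cell0 := PseudoFunctor C; cell1 := PNCat; id1 := pn_id; hcomp := pn_hcomp;
     hcomp_idl := pn_hcomp_idl; hcomp_idr := pn_hcomp_idr; hcomp_assoc := pn_hcomp_assoc |}.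

Record PCOb (C : Category) (F : PseudoFunctor C) := {
  pc_fam :> forall X : C, F X;
  pc_tau : forall (X Y : C) (f : hom X Y), Iso (pf_map F f (pc_fam Y)) (pc_fam X);
  pc_tau_comp : forall (X Y Z : C) (f : hom X Y) (g : hom Y Z),
      pc_tau (g ∘ f) ∘ pf_phi F f g (pc_fam Z) = pc_tau f ∘ fmap (pf_map F f) (pc_tau g) }.
Arguments pc_tau {_ _} _ {_ _} _.
Arguments pc_tau_comp {_ _} _ {_ _ _} _ _.

Record PCHom (C : Category) (F : PseudoFunctor C) (A B : PCOb F) := {
  pc_mor :> forall X : C, hom (A X) (B X);
  pc_mor_tau : forall (X Y : C) (f : hom X Y),
      pc_tau B f ∘ fmap (pf_map F f) (pc_mor Y) = pc_mor X ∘ pc_tau A f }.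
Arguments pc_mor {_ _ _ _} _ _.
Arguments pc_mor_tau {_ _ _ _} _ {_ _} _.

Section PC.
Context {C : Category}.
Implicit Types F E G : PseudoFunctor C.

Lemma pc_hom_eq F (A B : PCOb F) (u v : PCHom A B) : (forall X, u X = v X) -> u = v.
Proof.
case: u v => [u un] [v vn] /= H.
have E' : u = v by apply: functional_extensionality_dep.
by subst v; rewrite (proof_irrelevance _ un vn).
Qed.

Lemma pc_ob_eq F (A B : PCOb F) (e : forall X, A X = B X) :
  (forall (X Y : C) (f : hom X Y) (e1 : pf_map F f (A Y) = pf_map F f (B Y)),
     can (e X) ∘ pc_tau A f = pc_tau B f ∘ can e1) -> A = B.
Proof.
case: A B e => [A At Ac] [B Bt Bc] /= e H.
have E' : A = B by apply: functional_extensionality_dep.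
subst B.
have E' : At = Bt.
  apply: functional_extensionality_dep => X.
  apply: functional_extensionality_dep => Y.
  apply: functional_extensionality_dep => f.
  by apply: iso_eq; move: (H X Y f eq_refl); rewrite !can_loop /= comp_idl comp_idr.
by subst Bt; rewrite (proof_irrelevance _ Ac Bc).
Qed.

Definition pc_id F (A : PCOb F) : PCHom A A.
Proof.
refine {| pc_mor := fun X => idm (A X) |}.
abstract (by move=> X Y f; rewrite fmap_id comp_idl comp_idr).
Defined.

Definition pc_comp F (A B D : PCOb F) (v : PCHom B D) (u : PCHom A B) : PCHom A D.
Proof.
refine {| pc_mor := fun X => v X ∘ u X |}.
abstract (by move=> X Y f; rewrite fmap_comp -comp_assoc pc_mor_tau !comp_assoc pc_mor_tau).
Defined.

Definition PC0 F : Category.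
Proof.
refine {| ob := PCOb F; hom := @PCHom C F; idm := @pc_id F; comp := @pc_comp F |}.
- abstract (by move=> *; apply: pc_hom_eq => X /=; rewrite comp_idl).
- abstract (by move=> *; apply: pc_hom_eq => X /=; rewrite comp_idr).
- abstract (by move=> *; apply: pc_hom_eq => X /=; rewrite comp_assoc).
Defined.

Lemma pc_can F (A B : PC0 F) (e : A = B) (X : C)
    (eX : pc_fam A X = pc_fam B X) : pc_mor (can e) X = can eX.
Proof. by subst B; rewrite (can_loop eX). Qed.

Lemma pc_can_nat F (A B A' B' : PCOb F) (u : PCHom A B) (u' : PCHom A' B')
    (e : B = B') (e' : A = A')
    (eb : forall X, B X = B' X) (ea : forall X, A X = A' X) :
  (forall X, can (eb X) ∘ u X = u' X ∘ can (ea X)) ->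
  can (e : B = B' :> PC0 F) ∘ (u : hom (_ : PC0 F) _) =
  (u' : hom (_ : PC0 F) _) ∘ can (e' : A = A' :> PC0 F).
Proof.
by move=> H; apply: pc_hom_eq => X /=; move: (H X); rewrite -(pc_can e) -(pc_can e').
Qed.

Lemma pn_inv_nat F E (h : PseudoNat F E) (X Y : C) (f : hom X Y) (A B : F Y) (u : hom A B) :
  bwd (pn_iso h f B) ∘ fmap (pf_map E f) (fmap (pn_fun h Y) u) =
  fmap (pn_fun h X) (fmap (pf_map F f) u) ∘ bwd (pn_iso h f A).
Proof. exact: iso_swap (pn_iso_nat h f u). Qed.

Lemma pn_inv_comp F E (h : PseudoNat F E) (X Y Z : C) (f : hom X Y) (g : hom Y Z) (A : F Z) :
  bwd (pn_iso h (g ∘ f) A) ∘ pf_phi E f g (pn_fun h Z A) =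
  fmap (pn_fun h X) (pf_phi F f g A) ∘
    (bwd (pn_iso h f (pf_map F g A)) ∘ fmap (pf_map E f) (bwd (pn_iso h g A))).
Proof.
exact: (@iso_swap _ _ _ _ _
          (iso_comp (fmap_iso (pf_map E f) (pn_iso h g A)) (pn_iso h f (pf_map F g A)))
          (pn_iso h (g ∘ f) A) (fmap (pn_fun h X) (pf_phi F f g A))
          (pf_phi E f g (pn_fun h Z A)) (pn_iso_comp h f g A)).
Qed.

Lemma md_inv F E (h k : PseudoNat F E) (s : Modification h k) (X Y : C) (f : hom X Y) (A : F Y) :
  bwd (pn_iso k f A) ∘ fmap (pf_map E f) (md_nt s Y A) =
  md_nt s X (pf_map F f A) ∘ bwd (pn_iso h f A).
Proof. exact: iso_swap (md_iso s f A). Qed.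

Definition pc_fun_ob F E (h : PseudoNat F E) (A : PCOb F) : PCOb E.
Proof.
refine {| pc_fam := fun X => pn_fun h X (A X);
          pc_tau := fun X Y f =>
            iso_comp (fmap_iso (pn_fun h X) (pc_tau A f)) (iso_inv (pn_iso h f (A Y))) |}.
abstract (move=> X Y Z f g /=;
  rewrite comp_assoc pn_inv_comp -comp_assoc -fmap_comp pc_tau_comp !fmap_comp !comp_assoc;
  by rewrite -(comp_assoc (fmap _ (fmap _ _))) -pn_inv_nat !comp_assoc).
Defined.

Definition pc_fun_hom F E (h : PseudoNat F E) (A B : PCOb F) (u : PCHom A B) :
  PCHom (pc_fun_ob h A) (pc_fun_ob h B).
Proof.
refine {| pc_mor := fun X =>
            (fmap (pn_fun h X) (u X) : hom (pc_fun_ob h A X) (pc_fun_ob h B X)) |}.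
abstract (move=> X Y f /=;
  by rewrite comp_assoc pn_inv_nat -!comp_assoc -!fmap_comp pc_mor_tau).
Defined.

Definition pc_fun F E (h : PseudoNat F E) : Functor (PC0 F) (PC0 E).
Proof.
refine {| fob := fun A : PC0 F => pc_fun_ob h A : PC0 E;
          fmap := fun A B u => pc_fun_hom h u |}.
- abstract (by move=> A; apply: pc_hom_eq => X /=; rewrite fmap_id).
- abstract (by move=> *; apply: pc_hom_eq => X /=; rewrite fmap_comp).
Defined.

Definition pc_md_at F E (h k : PseudoNat F E) (s : Modification h k) (A : PCOb F) :
  PCHom (pc_fun_ob h A) (pc_fun_ob k A).
Proof.
refine {| pc_mor := fun X =>
            (md_nt s X (A X) : hom (pc_fun_ob h A X) (pc_fun_ob k A X)) |}.
abstract (by move=> X Y f /=; rewrite comp_assoc md_inv -!comp_assoc nt_nat).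
Defined.

Definition pc_md F E (h k : PseudoNat F E) (s : Modification h k) :
  NatTrans (pc_fun h) (pc_fun k).
Proof.
refine {| nt := fun A => (pc_md_at s A : hom (pc_fun h A) (pc_fun k A)) |}.
abstract (by move=> A B u; apply: pc_hom_eq => X /=; rewrite nt_nat).
Defined.

Definition PC1 F E : Functor (PNCat F E) (FunCat (PC0 F) (PC0 E)).
Proof.
refine {| fob := fun h : PNCat F E => pc_fun h : FunCat (PC0 F) (PC0 E);
          fmap := fun h k s => pc_md s |}.
- abstract (by move=> h; apply: nt_eq => A; apply: pc_hom_eq).
- abstract (by move=> *; apply: nt_eq => A; apply: pc_hom_eq).
Defined.

Lemma PC_id_ob F (A : PCOb F) : pc_fun_ob (pn_id F) A = A.
Proof.
unshelve eapply pc_ob_eq => // X Y f e1 /=.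
by rewrite can_loop !comp_idr comp_idl.
Qed.

Lemma PC_comp_ob F E G (k : PseudoNat E G) (h : PseudoNat F E) (A : PCOb F) :
  pc_fun_ob (pn_comp k h) A = pc_fun_ob k (pc_fun_ob h A).
Proof.
unshelve eapply pc_ob_eq => // X Y f e1 /=.
by rewrite can_loop comp_idr comp_idl fmap_comp !comp_assoc.
Qed.

Lemma PC_id F : PC1 F F (pn_id F) = FId (PC0 F).
Proof.
unshelve eapply functor_eq; first by move=> A; exact: PC_id_ob.
move=> A B u; unshelve eapply pc_can_nat => //= X.
by rewrite comp_idl comp_idr.
Qed.

Lemma PC_comp F E G (k : PseudoNat E G) (h : PseudoNat F E) :
  pc_fun (pn_comp k h) = pc_fun k ∘F pc_fun h.
Proof.
unshelve eapply functor_eq; first by move=> A; exact: PC_comp_ob.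
move=> A B u; unshelve eapply pc_can_nat => //= X.
by rewrite comp_idl comp_idr.
Qed.

Lemma PC_hcomp F E G :
  PC1 F G ∘F pn_hcomp F E G = cat_hcomp (PC0 F) (PC0 E) (PC0 G) ∘F FProd (PC1 E G) (PC1 F E).
Proof.
unshelve eapply functor_eq; first by move=> p; exact: PC_comp.
move=> p q s; unshelve eapply fun_can_nat; try (by move=> A; exact: PC_comp_ob).
move=> A; unshelve eapply pc_can_nat => //= X.
by rewrite comp_idl comp_idr.
Qed.
End PC.

Definition PC (C : Category) : TwoFunctor (Bicat C) CatTwoCat :=
  {| tf0 := (fun F => PC0 F) : Bicat C -> CatTwoCat; tf1 := PC1;
     tf_id := PC_id; tf_hcomp := PC_hcomp |}.

(* The data [(ΦX, ΦT, Φp, Φ0, Φadd, Φℓ, Φc)], where Φ(T T) = ΦT ΦT and Φ(id) = id are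
   used through [can]. *)
Definition map_data (K L : TwoCat) (P : TwoFunctor K L) (d : TanData K) : TanData L :=
  {| td_ob := P (td_ob d);
     td_T := tf1 P (td_T d);
     td_p := can (tf_id P _) ∘ fmap (tf1 P) (td_p d);
     td_0 := fmap (tf1 P) (td_0 d) ∘ can (eq_sym (tf_id P _));
     td_Tn := fun n => tf1 P (td_Tn d n);
     td_base := fun n => can (tf_id P _) ∘ fmap (tf1 P) (td_base d n);
     td_pr := fun n i => fmap (tf1 P) (td_pr d n i);
     td_add := fmap (tf1 P) (td_add d);
     td_l := can (tf_comp1 P _ _) ∘ fmap (tf1 P) (td_l d);
     td_c := can (tf_comp1 P _ _) ∘ fmap (tf1 P) (td_c d) ∘ can (eq_sym (tf_comp1 P _ _)) |}.

(* Carrying the boundary of [α : h T ⇒ S h] along allows comparing such 2-cells when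
   the tangent data are only propositionally equal. *)
Record TanSquare (K : TwoCat) := {
  sq_dom : TanData K;
  sq_cod : TanData K;
  sq_1 : cell1 sq_dom sq_cod;
  sq_2 : hom (sq_1 ⊙ td_T sq_dom) (td_T sq_cod ⊙ sq_1) }.

Definition square_of (K : TwoCat) (X Y : TanData K) (f : TanMor X Y) : TanSquare K :=
  {| sq_2 := tm_2 f |}.

Definition map_square (K L : TwoCat) (P : TwoFunctor K L) (q : TanSquare K) : TanSquare L :=
  {| sq_dom := map_data P (sq_dom q);
     sq_cod := map_data P (sq_cod q);
     sq_1 := tf1 P (sq_1 q) : cell1 (map_data P (sq_dom q)) (map_data P (sq_cod q));
     sq_2 := can (tf_comp1 P _ _) ∘ fmap (tf1 P) (sq_2 q) ∘ can (eq_sym (tf_comp1 P _ _)) |}.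

Lemma pc_nt_can (C : Category) (F E : PseudoFunctor C) (P Q : FunCat (PC0 F) (PC0 E))
    (e : P = Q) (A : PC0 F) (X : C) (eX : pc_fam (fob P A) X = pc_fam (fob Q A) X) :
  pc_mor (nt (can e) A) X = can eX.
Proof. by subst Q; rewrite (can_loop eX). Qed.

(* The [can]s above are identities: the images have the componentwise description. *)
Section MapDataComponents.
Context {C : Category} (d : TanData (Bicat C)).
Let u := map_data (PC C) d.
Let T (A : PCOb (td_ob d)) : PCOb (td_ob d) := pc_fun_ob (td_T d) A.

Lemma map_data_p (A : PCOb (td_ob d)) (X : C) :
  pc_mor (nt (td_p u) A : PCHom (T A) A) X = md_nt (td_p d) X (A X).
Proof.
refine (eq_trans (f_equal (fun x => comp (x : hom (A X) (A X)) (md_nt (td_p d) X (A X)))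
  (@pc_nt_can _ _ _ _ _ (tf_id (PC C) (td_ob d)) A X (eq_refl (A X)))) (comp_idl _)).
Qed.

Lemma map_data_0 (A : PCOb (td_ob d)) (X : C) :
  pc_mor (nt (td_0 u) A : PCHom A (T A)) X = md_nt (td_0 d) X (A X).
Proof.
exact (eq_trans (f_equal (fun x => comp (md_nt (td_0 d) X (A X)) (x : hom (A X) (A X)))
  (@pc_nt_can _ _ _ _ _ (eq_sym (tf_id (PC C) (td_ob d))) A X (eq_refl (A X)))) (comp_idr _)).
Qed.

Lemma map_data_l (A : PCOb (td_ob d)) (X : C) :
  pc_mor (nt (td_l u) A : PCHom (T A) (T (T A))) X = md_nt (td_l d) X (A X).
Proof.
exact (eq_trans (f_equal (fun x => comp (x : hom (T (T A) X) (T (T A) X)) (md_nt (td_l d) X (A X)))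
  (@pc_nt_can _ _ _ _ _ (tf_comp1 (PC C) (td_T d) (td_T d)) A X
     (eq_refl (T (T A) X)))) (comp_idl _)).
Qed.

Lemma can_conj_id (D : Category) (a b : D) (v : hom b b) (f : hom a b) (w : hom a a) :
  v = idm b -> w = idm a -> v ∘ f ∘ w = f.
Proof. by move=> -> ->; rewrite comp_idl comp_idr. Qed.

Lemma map_data_c (A : PCOb (td_ob d)) (X : C) :
  pc_mor (nt (td_c u) A : PCHom (T (T A)) (T (T A))) X = md_nt (td_c d) X (A X).
Proof.
exact (can_conj_id (md_nt (td_c d) X (A X))
  (@pc_nt_can _ _ _ _ _ (tf_comp1 (PC C) (td_T d) (td_T d)) A X (eq_refl (T (T A) X)))
  (@pc_nt_can _ _ _ _ _ (eq_sym (tf_comp1 (PC C) (td_T d) (td_T d))) A X (eq_refl (T (T A) X)))).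
Qed.
End MapDataComponents.

Lemma map_square_2 (C : Category) (q : TanSquare (Bicat C)) (A : PCOb (td_ob (sq_dom q))) (X : C) :
  pc_mor (nt (sq_2 (map_square (PC C) q)) A :
    PCHom (pc_fun_ob (sq_1 q) (pc_fun_ob (td_T (sq_dom q)) A))
          (pc_fun_ob (td_T (sq_cod q)) (pc_fun_ob (sq_1 q) A))) X =
  md_nt (sq_2 q) X (A X).
Proof.
exact (can_conj_id (md_nt (sq_2 q) X (A X))
  (@pc_nt_can _ _ _ _ _ (tf_comp1 (PC C) (td_T (sq_cod q)) (sq_1 q)) A X
     (eq_refl (pc_fam (pc_fun_ob (td_T (sq_cod q)) (pc_fun_ob (sq_1 q) A)) X)))
  (@pc_nt_can _ _ _ _ _ (eq_sym (tf_comp1 (PC C) (sq_1 q) (td_T (sq_dom q)))) A X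
     (eq_refl (pc_fam (pc_fun_ob (sq_1 q) (pc_fun_ob (td_T (sq_dom q)) A)) X)))).
Qed.

(* Main.v *)
From Stdlib Require Import ssreflect FunctionalExtensionality ProofIrrelevance.
From Stdlib Require Fin.
Require Import Defs.

(** A strict 2-functor preserves the equations between pasted 2-cells, so it sends
    lax tangent morphisms and their 2-cells to such, compatibly with composition.
    What a 2-functor need not preserve is the universal properties.  They hold here
    because [PC] is represented by the terminal pseudofunctor [1]: evaluation at the
    unique object of [PC 1] is an equivalence [Bicat(1, F) ~ PC F], and pointwiseness
    of the limits, applied to the 1-cell [1 -> F] naming an object [A], gives the
    universal property at [A].  That [T^m] preserves [T_n] at [A] is not part of the
    pointwise hypothesis; it follows from the isomorphism [T^m T = T T^m] over [T^m]
    built from [c], which identifies [T^m T_n] with the pointwise power [T_n T^m].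
    Finally, as [p] retracts [0], the pullback square in the last axiom of a tangent
    object exhibits the lift as the equalizer required of a tangent category. *)

Set Implicit Arguments.
Unset Strict Implicit.
Unset Printing Implicit Defensive.

(** * Lifting a 2-functor along tangent morphisms *)

(** Structural cells unfold to [can], and whiskering or mapping a [can] gives a [can] again.
    Equality proofs being irrelevant, merged chains with the same endpoints agree by [can_irr]. *)
Ltac mergecan :=
  rewrite /lun /luni /run /runi /asc /asci ?(wl_can, wr_can, fmap_can) ?can_comp.

(** By [is_tangent_morphismE] the axioms of a tangent morphism reduce to commuting squares of this
    shape. Stacking squares separates the image of an axiom from the identities by which [map_data]
    adjusts boundaries. *)
Lemma sq_comp (K : TwoCat) (X Y : K) (h : cell1 X Y)
    (t t' t'' : cell1 X X) (s s' s'' : cell1 Y Y)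
    (a : hom (h ⊙ t) (s ⊙ h)) (a' : hom (h ⊙ t') (s' ⊙ h)) (a'' : hom (h ⊙ t'') (s'' ⊙ h))
    (x : hom t t') (x' : hom t' t'') (y : hom s s') (y' : hom s' s'') :
  a'' ∘ wl h x' = wr y' h ∘ a' -> a' ∘ wl h x = wr y h ∘ a ->
  a'' ∘ wl h (x' ∘ x) = wr (y' ∘ y) h ∘ a.
Proof. by move=> H' H; rewrite wl_comp wr_comp comp_assoc -H -!comp_assoc H'. Qed.

Lemma sq_can (K : TwoCat) (X Y : K) (h : cell1 X Y) (t t' : cell1 X X) (s s' : cell1 Y Y)
    (et : t = t') (es : s = s') (e : h ⊙ t = s ⊙ h) (e' : h ⊙ t' = s' ⊙ h) :
  can e' ∘ wl h (can et) = wr (can es) h ∘ can e.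
Proof. by mergecan; apply: can_irr. Qed.

(** In [map_data] the boundary identities also occur inverted, on the source of [td_0] and of
    [td_c]. *)
Lemma sq_sym (K : TwoCat) (X Y : K) (h : cell1 X Y) (t t' : cell1 X X) (s s' : cell1 Y Y)
    (et : t = t') (es : s = s') (a : hom (h ⊙ t) (s ⊙ h)) (a' : hom (h ⊙ t') (s' ⊙ h)) :
  a' ∘ wl h (can et) = wr (can es) h ∘ a ->
  a ∘ wl h (can (eq_sym et)) = wr (can (eq_sym es)) h ∘ a'.
Proof.
subst t' s'; rewrite /wl /wr /= !comp2_id !comp_idl !comp_idr; exact: eq_sym.
Qed.

Section LiftTwoFunctor.
Context {K L : TwoCat} (P : TwoFunctor K L).

(** [tf_hcomp] is an equality of functors; its action on 2-cells is the naturality of the identities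
    [tf_comp1]. *)
Lemma tf_comp2 (X Y Z : K) (g g' : cell1 Y Z) (f f' : cell1 X Y)
    (s : hom g g') (r : hom f f') :
  can (tf_comp1 P g' f') ∘ fmap (tf1 P) (comp2 s r) =
  comp2 (fmap (tf1 P) s) (fmap (tf1 P) r) ∘ can (tf_comp1 P g f).
Proof. exact: (@functor_eq_nat _ _ _ _ (tf_hcomp P X Y Z) (g, f) (g', f') (s, r)). Qed.

Lemma tf_wl (X Y Z : K) (g : cell1 Y Z) (f f' : cell1 X Y) (r : hom f f') :
  can (tf_comp1 P g f') ∘ fmap (tf1 P) (wl g r) =
  wl (tf1 P g) (fmap (tf1 P) r) ∘ can (tf_comp1 P g f).
Proof. by rewrite /wl tf_comp2 fmap_id. Qed.

Lemma tf_wr (X Y Z : K) (g g' : cell1 Y Z) (f : cell1 X Y) (s : hom g g') :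
  can (tf_comp1 P g' f) ∘ fmap (tf1 P) (wr s f) =
  wr (fmap (tf1 P) s) (tf1 P f) ∘ can (tf_comp1 P g f).
Proof. by rewrite /wr tf_comp2 fmap_id. Qed.

(** The formula is that of [sq_2] in [map_square], so the description of the lift on 1-cells holds
    by computation. *)
Definition tf_sq (X Y : K) (h : cell1 X Y) (t : cell1 X X) (s : cell1 Y Y)
    (a : hom (h ⊙ t) (s ⊙ h)) :
  hom (tf1 P h ⊙ tf1 P t) (tf1 P s ⊙ tf1 P h) :=
  can (tf_comp1 P _ _) ∘ fmap (tf1 P) a ∘ can (eq_sym (tf_comp1 P _ _)).

Lemma tf_sq_nat (X Y : K) (h : cell1 X Y) (t t' : cell1 X X) (s s' : cell1 Y Y)
    (a : hom (h ⊙ t) (s ⊙ h)) (a' : hom (h ⊙ t') (s' ⊙ h)) (x : hom t t') (y : hom s s') :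
  a' ∘ wl h x = wr y h ∘ a ->
  tf_sq a' ∘ wl (tf1 P h) (fmap (tf1 P) x) = wr (fmap (tf1 P) y) (tf1 P h) ∘ tf_sq a.
Proof.
move=> H; rewrite /tf_sq (conj_can' (tf_wl h x)) (conj_can' (tf_wr h y)).
rewrite !comp_assoc !can_compA !can_loopA; congr (_ ∘ _).
by rewrite -!comp_assoc -!fmap_comp H.
Qed.

Lemma tf_sq_2cell (X Y : K) (h k : cell1 X Y) (t : cell1 X X) (s : cell1 Y Y)
    (a : hom (h ⊙ t) (s ⊙ h)) (b : hom (k ⊙ t) (s ⊙ k)) (r : hom h k) :
  wl s r ∘ a = b ∘ wr r t ->
  wl (tf1 P s) (fmap (tf1 P) r) ∘ tf_sq a = tf_sq b ∘ wr (fmap (tf1 P) r) (tf1 P t).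
Proof.
move=> H; rewrite /tf_sq (conj_can' (tf_wl s r)) (conj_can' (tf_wr t r)).
rewrite !comp_assoc !can_compA !can_loopA; congr (_ ∘ _).
by rewrite -!comp_assoc -!fmap_comp H.
Qed.

Lemma tf_sq_can (X Y : K) (h : cell1 X Y) (t : cell1 X X) (s : cell1 Y Y)
    (e : h ⊙ t = s ⊙ h) (e' : tf1 P h ⊙ tf1 P t = tf1 P s ⊙ tf1 P h) :
  tf_sq (can e) = can e'.
Proof. by rewrite /tf_sq; mergecan; apply: can_irr. Qed.

(** On both sides the images of [a] and [b] occur in the same order, with only identities around
    them. This is what makes the lift strictly compatible with composition. *)
Lemma tf_sq_paste (X Y Z : K) (g : cell1 Y Z) (h : cell1 X Y)
    (t : cell1 X X) (s : cell1 Y Y) (r : cell1 Z Z)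
    (b : hom (g ⊙ s) (r ⊙ g)) (a : hom (h ⊙ t) (s ⊙ h)) :
  wl (tf1 P r) (can (tf_comp1 P g h)) ∘ tf_sq (paste b a) =
  paste (tf_sq b) (tf_sq a) ∘ wr (can (tf_comp1 P g h)) (tf1 P t).
Proof.
rewrite /tf_sq /paste !(fmap_comp, wl_comp, wr_comp).
rewrite (conj_can (tf_wl g a)) (conj_can (tf_wr h b)).
mergecan.
rewrite !comp_assoc !can_compA !can_comp.
by repeat (congr (_ ∘ _); try apply: can_irr).
Qed.

(** Serves the axioms for [td_l] and [td_c]: in [L] they involve the square of the image of [T], not
    the image of its square. *)
Lemma tf_sq_twice (X Y : K) (h : cell1 X Y) (t : cell1 X X) (s : cell1 Y Y)
    (a : hom (h ⊙ t) (s ⊙ h)) :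
  twice (tf_sq a) ∘ wl (tf1 P h) (can (tf_comp1 P t t)) =
  wr (can (tf_comp1 P s s)) (tf1 P h) ∘ tf_sq (twice a).
Proof.
rewrite /tf_sq /twice !(fmap_comp, wl_comp, wr_comp).
rewrite (conj_can (tf_wl s a)) (conj_can (tf_wr t a)).
mergecan.
rewrite !comp_assoc !can_compA !can_comp.
by repeat (congr (_ ∘ _); try apply: can_irr).
Qed.

Lemma map_tan_mor_ax (X Y : TanData K) (f : TanMor X Y) :
  @IsTangentMorphism L (map_data P X) (map_data P Y) (tf1 P (tm_1 f)) (tf_sq (tm_2 f)).
Proof.
have e : tm_1 f ⊙ id1 X = id1 Y ⊙ tm_1 f by rewrite comp1_idl comp1_idr.
have e' : tf1 P (tm_1 f) ⊙ tf1 P (id1 X) = tf1 P (id1 Y) ⊙ tf1 P (tm_1 f)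
  by rewrite -!tf_comp1 e.
have e'' : tf1 P (tm_1 f) ⊙ id1 (P X) = id1 (P Y) ⊙ tf1 P (tm_1 f)
  by rewrite comp1_idl comp1_idr.
have /(is_tangent_morphismE _ e) [hp [h0 [[h2 [hpr hadd]] [hl hc]]]] := tm_ax f.
apply/(@is_tangent_morphismE L (map_data P X) (map_data P Y) _ _ e'').
(* This square replaces the image of an identity 1-cell by the identity itself. It is stacked below
   the image of the axiom for [td_p], and its inverse above the image of the axiom for [td_0]. *)
have e2 := sq_can (tf_id P X) (tf_id P Y) e' e''.
split.
  by apply: (sq_comp e2); rewrite -(tf_sq_can e e'); exact: tf_sq_nat.
split.
  by apply: (sq_comp _ (sq_sym e2)); rewrite -(tf_sq_can e e'); exact: tf_sq_nat.
split.
  exists (tf_sq h2); split=> [i|]; exact: tf_sq_nat.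
split.
  by apply: (sq_comp (tf_sq_twice _)); exact: tf_sq_nat.
(* In [map_data] the cell [td_c] is conjugated, so the comparison square is needed at both ends. *)
apply: (sq_comp _ (sq_sym (tf_sq_twice _))).
by apply: (sq_comp (tf_sq_twice _)); exact: tf_sq_nat.
Qed.

Definition map_tan_mor (X Y : TanData K) (f : TanMor X Y) :
    TanMor (map_data P X) (map_data P Y) :=
  {| tm_1 := tf1 P (tm_1 f) : cell1 (map_data P X) (map_data P Y);
     tm_2 := tf_sq (tm_2 f); tm_ax := map_tan_mor_ax f |}.

Definition map_tan_cell (X Y : TanData K) (f g : TanMor X Y) (r : TanCell f g) :
  TanCell (map_tan_mor f) (map_tan_mor g) :=
  exist _ (fmap (tf1 P) (proj1_sig r)) (tf_sq_2cell (proj2_sig r)).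

Definition map_tan1 (X Y : TanData K) :
  Functor (TanHom X Y) (TanHom (map_data P X) (map_data P Y)).
Proof.
refine {| fob := fun f : TanHom X Y => map_tan_mor f : TanHom _ _;
          fmap := fun f g r => map_tan_cell r |}.
- abstract (by move=> f; apply: tan_cell_eq; exact: fmap_id).
- abstract (by move=> *; apply: tan_cell_eq; exact: fmap_comp).
Defined.

Lemma map_tan_id (X : TanData K) : map_tan_mor (tan_id X) = tan_id (map_data P X).
Proof.
apply: (@tan_mor_eq _ _ _ (map_tan_mor (tan_id X)) (tan_id (map_data P X)) (tf_id P X)).
rewrite /= /tf_sq; mergecan; exact: can_irr.
Qed.

Lemma map_tan_comp (X Y Z : TanData K) (g : TanMor Y Z) (f : TanMor X Y) :
  map_tan_mor (tan_comp g f) = tan_comp (map_tan_mor g) (map_tan_mor f).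
Proof.
apply: (@tan_mor_eq _ _ _ (map_tan_mor (tan_comp g f))
          (tan_comp (map_tan_mor g) (map_tan_mor f)) (tf_comp1 P (tm_1 g) (tm_1 f))).
exact: tf_sq_paste.
Qed.

Lemma map_tan_hcomp (X Y Z : TanData K) :
  map_tan1 X Z ∘F tan_hcomp X Y Z =
  tan_hcomp (map_data P X) (map_data P Y) (map_data P Z) ∘F
    FProd (map_tan1 Y Z) (map_tan1 X Y).
Proof.
unshelve eapply functor_eq; first by move=> p; exact: map_tan_comp.
move=> [g f] [g' f'] [s r]; eapply tan_can_nat => eb ea.
exact (@functor_eq_nat _ _ _ _ (tf_hcomp P X Y Z) (tm_1 g, tm_1 f) (tm_1 g', tm_1 f')
        (proj1_sig s, proj1_sig r) ea eb).
Qed.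
End LiftTwoFunctor.

(** The predicates are arbitrary because the axioms differ on the two sides: those of a tangent
    object in the source, the objectwise ones of a tangent category in the target. Only [HP] depends
    on the particular 2-functor. *)
Definition TanLift (K L : TwoCat) (P : TwoFunctor K L)
    (S : TanData K -> Prop) (S' : TanData L -> Prop)
    (HP : forall d, S d -> S' (map_data P d)) :
  TwoFunctor (@TanTwoCat K {d | S d} (fun d => proj1_sig d))
             (@TanTwoCat L {d | S' d} (fun d => proj1_sig d)) :=
  @Build_TwoFunctor (@TanTwoCat K {d | S d} (fun d => proj1_sig d))
    (@TanTwoCat L {d | S' d} (fun d => proj1_sig d))
    (fun X => exist S' (map_data P (proj1_sig X)) (HP _ (proj2_sig X)))
    (fun X Y => map_tan1 P (proj1_sig X) (proj1_sig Y))
    (fun X => map_tan_id P (proj1_sig X))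
    (fun X Y Z => map_tan_hcomp P (proj1_sig X) (proj1_sig Y) (proj1_sig Z)).

Lemma two_functor_irr (K L : TwoCat) (o : K -> L)
    (m m' : forall X Y, Functor (cell1 X Y) (cell1 (o X) (o Y))) i i' c c' :
  (forall X Y, m X Y = m' X Y) ->
  @Build_TwoFunctor K L o m i c = @Build_TwoFunctor K L o m' i' c'.
Proof.
move=> H; have E : m = m'.
  by apply: functional_extensionality_dep => X; apply: functional_extensionality_dep => Y.
by subst m'; rewrite (proof_irrelevance _ i i') (proof_irrelevance _ c c').
Qed.

(** The lift acts on underlying 1-cells and 2-cells as [P] does, so the two composites have the same
    data and differ in proofs only. *)
Lemma tan_lift_forget (K L : TwoCat) (P : TwoFunctor K L)
    (S : TanData K -> Prop) (S' : TanData L -> Prop)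
    (HP : forall d, S d -> S' (map_data P d)) :
  TFComp (TanForget (fun d : {d | S' d} => proj1_sig d)) (TanLift HP) =
  TFComp P (TanForget (fun d : {d | S d} => proj1_sig d)).
Proof. by apply: two_functor_irr => X Y; exact: functor_irr. Qed.

(** * Limits and whiskering *)

Definition can_iso (D : Category) (a b : D) (e : a = b) : Iso a b :=
  {| fwd := can e; bwd := can (eq_sym e); bwd_fwd := can_sym_l e; fwd_bwd := can_sym_r e |}.

Lemma is_power_iso (D : Category) (x b P x' b' P' : D) (q : hom x b) (r : hom P b)
    (q' : hom x' b') (r' : hom P' b') n (u : Fin.t n -> hom P x) (u' : Fin.t n -> hom P' x')
    (i : Iso x x') (j : Iso b b') (v : Iso P P') :
  j ∘ q = q' ∘ i -> j ∘ r = r' ∘ v -> (forall k, i ∘ u k = u' k ∘ v) ->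
  IsPower q r u -> IsPower q' r' u'.
Proof.
move=> Hq Hr Hu [H1 H2].
have Er : r' = j ∘ r ∘ bwd v by rewrite Hr comp_assoc fwd_bwd comp_idr.
have Eu k : u' k = i ∘ u k ∘ bwd v by rewrite Hu comp_assoc fwd_bwd comp_idr.
have Eq : bwd j ∘ q' = q ∘ bwd i by apply: iso_swap.
split.
  by move=> k; rewrite Eu Er -!comp_assoc -Hq (comp_assoc j) H1.
move=> Z s w Hw.
case: (H2 Z (bwd j ∘ s) (fun k => bwd i ∘ w k)).
  by move=> k; rewrite -comp_assoc -Eq comp_assoc Hw.
move=> y [[y1 y2] y3]; exists (v ∘ y); split.
  split; first by rewrite -comp_assoc -Hr comp_assoc y1 -comp_assoc fwd_bwd comp_idl.
  by move=> k; rewrite -comp_assoc -Hu comp_assoc y2 -comp_assoc fwd_bwd comp_idl.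
move=> y' [z1 z2].
suff Hy : y = bwd v ∘ y' by rewrite Hy -comp_assoc fwd_bwd comp_idl.
apply: y3; split; first by rewrite -z1 Er -!comp_assoc bwd_fwd comp_idl.
by move=> k; rewrite -z2 Eu -!comp_assoc bwd_fwd comp_idl.
Qed.

Lemma is_power_unique (D : Category) (x b P P' : D) (q : hom x b) n
    (r : hom P b) (u : Fin.t n -> hom P x) (r' : hom P' b) (u' : Fin.t n -> hom P' x) :
  IsPower q r u -> IsPower q r' u' ->
  exists v : Iso P P', r = r' ∘ v /\ forall k, u k = u' k ∘ v.
Proof.
move=> [H1 H2] [H1' H2'].
case: (H2' P r u H1) => v [[v1 v2] _].
case: (H2 P' r' u' H1') => w [[w1 w2] _].
have E : w ∘ v = idm P.
  case: (H2 P r u H1) => y [_ Hy].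
  transitivity y; [symmetry|]; apply: Hy; split=> [|k]; rewrite ?comp_idr //.
    by rewrite -comp_assoc w1 v1.
  by rewrite -comp_assoc w2 v2.
have E' : v ∘ w = idm P'.
  case: (H2' P' r' u' H1') => y [_ Hy].
  transitivity y; [symmetry|]; apply: Hy; split=> [|k]; rewrite ?comp_idr //.
    by rewrite -comp_assoc v1 w1.
  by rewrite -comp_assoc v2 w2.
by exists {| fwd := v; bwd := w; bwd_fwd := E; fwd_bwd := E' |}; split=> [|k] /=.
Qed.

Lemma is_pullback_iso (D : Category) (P a b c P' a' b' c' : D)
    (u : hom P a) (v : hom P b) (f : hom a c) (g : hom b c)
    (u' : hom P' a') (v' : hom P' b') (f' : hom a' c') (g' : hom b' c')
    (iP : Iso P P') (ia : Iso a a') (ib : Iso b b') (ic : Iso c c') :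
  ia ∘ u = u' ∘ iP -> ib ∘ v = v' ∘ iP -> ic ∘ f = f' ∘ ia -> ic ∘ g = g' ∘ ib ->
  IsPullback u v f g -> IsPullback u' v' f' g'.
Proof.
move=> Hu Hv Hf Hg [H1 H2].
have Eu : u' = ia ∘ u ∘ bwd iP by rewrite Hu comp_assoc fwd_bwd comp_idr.
have Ev : v' = ib ∘ v ∘ bwd iP by rewrite Hv comp_assoc fwd_bwd comp_idr.
have Ef : bwd ic ∘ f' = f ∘ bwd ia by apply: iso_swap.
have Eg : bwd ic ∘ g' = g ∘ bwd ib by apply: iso_swap.
split.
  by rewrite Eu Ev -!comp_assoc -Hf -Hg (comp_assoc ic) H1 !comp_assoc.
move=> Z s w Hw.
case: (H2 Z (bwd ia ∘ s) (bwd ib ∘ w)).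
  by rewrite -!comp_assoc -Ef -Eg !comp_assoc Hw.
move=> y [[y1 y2] y3]; exists (iP ∘ y); split.
  by split; rewrite -comp_assoc -?Hu -?Hv comp_assoc ?y1 ?y2 -comp_assoc fwd_bwd comp_idl.
move=> y' [z1 z2].
suff Hy : y = bwd iP ∘ y' by rewrite Hy -comp_assoc fwd_bwd comp_idl.
by apply: y3; split; rewrite -?z1 -?z2 ?Eu ?Ev -!comp_assoc bwd_fwd comp_idl.
Qed.

(** If [s k = z w], then applying the retraction [r] gives [w = g k]. A cone is thus determined by
    its leg [k], and the condition on [k] is [s k = z g k]. *)
Lemma is_equalizer_pullback (D : Category) (P a b c : D) (xi : hom P a) (t : hom P b)
    (s : hom a c) (z : hom b c) (g : hom a b) (r : hom c b) :
  r ∘ z = idm b -> r ∘ s = g -> IsPullback xi t s z -> IsEqualizer xi s (z ∘ g).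
Proof.
move=> Hz Hs [H1 H2]; split.
  by rewrite -Hs !comp_assoc H1 -(comp_assoc r) Hz comp_idl.
move=> Z k Hk; case: (H2 Z k (g ∘ k)).
  by rewrite Hk comp_assoc.
move=> w [[w1 w2] w3]; exists w; split=> // w' Hw'.
apply: w3; split=> //.
by rewrite -Hw' -Hs !comp_assoc -(comp_assoc s) H1 comp_assoc -(comp_assoc r) Hz comp_idl.
Qed.

(** * Powers under whiskering by iterates of [T] *)

Section Whisker.
Context {K : TwoCat}.

Definition wl_iso (X Y Z : K) (g : cell1 Y Z) (f f' : cell1 X Y) (i : Iso f f') :
  Iso (g ⊙ f) (g ⊙ f').
Proof.
refine {| fwd := wl g (fwd i); bwd := wl g (bwd i) |}.
- abstract (by rewrite -wl_comp bwd_fwd /wl comp2_id).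
- abstract (by rewrite -wl_comp fwd_bwd /wl comp2_id).
Defined.

Definition wr_iso (X Y Z : K) (g g' : cell1 Y Z) (f : cell1 X Y) (i : Iso g g') :
  Iso (g ⊙ f) (g' ⊙ f).
Proof.
refine {| fwd := wr (fwd i) f; bwd := wr (bwd i) f |}.
- abstract (by rewrite -wr_comp bwd_fwd /wr comp2_id).
- abstract (by rewrite -wr_comp fwd_bwd /wr comp2_id).
Defined.

(** The forward map is [paste] by computation, so [paste_sq] applies to it. *)
Definition paste_iso (X Y Z : K) (g : cell1 Y Z) (h : cell1 X Y)
    (t : cell1 X X) (s : cell1 Y Y) (r : cell1 Z Z)
    (b : Iso (g ⊙ s) (r ⊙ g)) (a : Iso (h ⊙ t) (s ⊙ h)) :
  Iso ((g ⊙ h) ⊙ t) (r ⊙ (g ⊙ h)) :=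
  iso_comp (can_iso (comp1_assoc r g h)) (iso_comp (wr_iso h b)
    (iso_comp (can_iso (eq_sym (comp1_assoc g s h)))
      (iso_comp (wl_iso g a) (can_iso (comp1_assoc g h t))))).

Lemma is_power_pow1 (d : TanData K) (m n : nat) (Y : K) (f : cell1 Y d) :
  let Tm := pow1 (td_T d) m in
  IsTangentObject d ->
  IsPower (wr (wl Tm (td_p d)) f) (wr (wl Tm (td_base d n)) f)
          (fun i => wr (wl Tm (td_pr d n i)) f).
Proof.
move=> Tm H.
have e0 : forall k, pow1 (td_T d) k ⊙ id1 d = id1 d ⊙ pow1 (td_T d) k
  by move=> k; rewrite comp1_idl comp1_idr.
(* [c] is an isomorphism [T T = T T] over [T], from [T p] to [p T]; iterate it. *)
have [a Ha] : exists a : Iso (Tm ⊙ td_T d) (td_T d ⊙ Tm),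
    can (e0 m) ∘ wl Tm (td_p d) = wr (td_p d) Tm ∘ a.
  rewrite /Tm; elim: m {Tm} => [|m [a Ha]] /=.
    exists (can_iso (eq_trans (comp1_idl (td_T d)) (eq_sym (comp1_idr (td_T d))))).
    exact: id_sq.
  have e1 : td_T d ⊙ id1 d = id1 d ⊙ td_T d by rewrite comp1_idl comp1_idr.
  pose c := {| fwd := td_c d; bwd := td_c d; bwd_fwd := to_c_c H; fwd_bwd := to_c_c H |}.
  (* Inside the outer [T], [a] moves the last factor past [T^m]; then [c] exchanges it with the
     outer [T]. *)
  exists (paste_iso c a).
  rewrite -(paste_can e1 (e0 m) (e0 (S m))).
  apply: (paste_sq Ha).
  change (can e1 ∘ wl (td_T d) (td_p d) = wr (td_p d) (td_T d) ∘ td_c d).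
  rewrite -[RHS]comp_idl -(can_sym_l (comp1_idl (td_T d))) !comp_assoc.
  rewrite -(comp_assoc (can (comp1_idl _))) (to_c_p H) /td_Tp /run can_compA.
  by congr (_ ∘ _); apply: can_irr.
have Hl := to_power_pres H m n.
have Hr := to_power_pointwise H n Tm.
(* Transport along the inverse of [a] turns the pointwise power at [Tm] into a second power of
   [wl Tm (td_p d)]. Uniqueness then compares it with the one in [Hl]. *)
have Hr' : IsPower (wl Tm (td_p d)) (can (eq_sym (e0 m)) ∘ wr (td_base d n) Tm)
    (fun k => bwd a ∘ wr (td_pr d n k) Tm).
  apply: (@is_power_iso _ _ _ _ _ _ _ _ _ _ _ n _ _ (iso_inv a)
           (can_iso (eq_sym (e0 m))) (iso_id _) _ _ _ Hr) => [|//=|k /=]; last by rewrite comp_idr.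
    exact: (@iso_swap _ _ _ _ _ a (can_iso (e0 m))).
  by rewrite comp_idr.
have [v [v1 v2]] := is_power_unique Hl Hr'.
(* Up to associativity, whiskering [T_n T^m] with [f] is whiskering [T_n] with [Tm ⊙ f], where the
   pointwise axiom applies. *)
apply: (@is_power_iso _ _ _ _ _ _ _ _ _ _ _ n _ _
   (iso_comp (wr_iso f (iso_inv a)) (can_iso (eq_sym (comp1_assoc (td_T d) Tm f))))
   (iso_comp (wr_iso f (can_iso (eq_sym (e0 m)))) (can_iso (eq_sym (comp1_assoc (id1 d) Tm f))))
   (iso_comp (wr_iso f (iso_inv v)) (can_iso (eq_sym (comp1_assoc (td_Tn d n) Tm f))))
   _ _ _ (to_power_pointwise H n (Tm ⊙ f))) => [||k] /=.
- rewrite !comp_assoc (asci_wr Tm f (td_p d)) -!comp_assoc -!wr_comp.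
  by congr (wr _ f ∘ _); exact: (@iso_swap _ _ _ _ _ a (can_iso (e0 m))).
- rewrite !comp_assoc (asci_wr Tm f (td_base d n)) -!comp_assoc -!wr_comp.
  by congr (wr _ f ∘ _); rewrite v1 comp_assoc fwd_bwd comp_idr.
- rewrite !comp_assoc (asci_wr Tm f (td_pr d n k)) -!comp_assoc -!wr_comp.
  by congr (wr _ f ∘ _); rewrite v2 comp_assoc fwd_bwd comp_idr.
Qed.
End Whisker.

(** * [PC] as a representable *)

(** Each test object is strictly of the form [G a], so a cone in [E] lifts through [G'] to a cone in
    [D] and is factored there. Uniqueness descends by faithfulness. *)
Lemma ff_is_power (D E : Category) (G : Functor D E)
    (G' : forall a b, hom (G a) (G b) -> hom a b)
    (GK : forall a b (f : hom (G a) (G b)), fmap G (G' a b f) = f)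
    (KG : forall a b (f : hom a b), G' a b (fmap G f) = f)
    (surj : forall z : E, exists a, G a = z)
    (x b P : D) (q : hom x b) n (r : hom P b) (u : Fin.t n -> hom P x) :
  IsPower q r u -> IsPower (fmap G q) (fmap G r) (fun i => fmap G (u i)).
Proof.
have inj : forall a b (f g : hom a b), fmap G f = fmap G g -> f = g.
  by move=> a c f g H; rewrite -(KG _ _ f) H KG.
move=> [H1 H2]; split; first by move=> i; rewrite -fmap_comp H1.
move=> Z s w Hw; case: (surj Z) => a Ha; subst Z.
case: (H2 a (G' _ _ s) (fun i => G' _ _ (w i))).
  by move=> i; apply: inj; rewrite fmap_comp !GK.
move=> y [[y1 y2] y3]; exists (fmap G y); split.
  by split=> [|i]; rewrite -fmap_comp ?y1 ?y2 GK.
move=> y' [z1 z2]; rewrite -(GK _ _ y'); congr (fmap G _); apply: y3.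
by split=> [|i]; apply: inj; rewrite fmap_comp !GK.
Qed.

Lemma ff_is_pullback (D E : Category) (G : Functor D E)
    (G' : forall a b, hom (G a) (G b) -> hom a b)
    (GK : forall a b (f : hom (G a) (G b)), fmap G (G' a b f) = f)
    (KG : forall a b (f : hom a b), G' a b (fmap G f) = f)
    (surj : forall z : E, exists a, G a = z)
    (P a b c : D) (u : hom P a) (v : hom P b) (f : hom a c) (g : hom b c) :
  IsPullback u v f g -> IsPullback (fmap G u) (fmap G v) (fmap G f) (fmap G g).
Proof.
have inj : forall a b (f g : hom a b), fmap G f = fmap G g -> f = g.
  by move=> a' b' f' g' H; rewrite -(KG _ _ f') H KG.
move=> [H1 H2]; split; first by rewrite -!fmap_comp H1.
move=> Z s w Hw; case: (surj Z) => z Hz; subst Z.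
case: (H2 z (G' _ _ s) (G' _ _ w)).
  by apply: inj; rewrite !fmap_comp !GK.
move=> y [[y1 y2] y3]; exists (fmap G y); split.
  by split; rewrite -fmap_comp ?y1 ?y2 GK.
move=> y' [z1 z2]; rewrite -(GK _ _ y'); congr (fmap G _); apply: y3.
by split; apply: inj; rewrite fmap_comp !GK.
Qed.

Section Representation.
Context {C : Category}.
Implicit Types F E G : PseudoFunctor C.

Definition UnitCat : Category.
Proof.
refine {| ob := unit; hom := fun _ _ => unit; idm := fun _ => tt;
          comp := fun _ _ _ _ _ => tt |}.
all: abstract (by repeat case).
Defined.

Definition pf_unit : PseudoFunctor C.
Proof.
refine {| pf_ob := fun _ : C => UnitCat; pf_map := fun _ _ _ => FId UnitCat;
          pf_phi := fun _ _ _ _ _ A => iso_id A |} => //.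
- abstract (by move=> X Y f A; exists eq_refl).
- abstract (by move=> X Y f A; exists eq_refl).
Defined.

Definition pc_pt : PCOb pf_unit :=
  {| pc_fam := fun X : C => tt : pf_unit X; pc_tau := fun X _ _ => @iso_id (pf_unit X) tt;
     pc_tau_comp := fun _ _ _ _ _ => eq_refl |}.

Lemma pc_tau_can F (A : PCOb F) (X Y : C) (f g : hom X Y) (e : f = g)
    (e' : pf_map F f (A Y) = pf_map F g (A Y)) :
  fwd (pc_tau A f) = pc_tau A g ∘ can e'.
Proof. by subst g; rewrite can_loop comp_idr. Qed.

Lemma iso_cancel (D : Category) (a b c : D) (i : Iso b c) (f g : hom a b) :
  i ∘ f = i ∘ g -> f = g.
Proof. by move=> H; rewrite -(comp_idl f) -(bwd_fwd i) comp_assoc H -comp_assoc bwd_fwd comp_idl. Qed.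

(** Cancelling the transition in its cocycle condition at two identities leaves [F(id)] of it equal
    to an identity, the compositor there being one. As [F(id)] is the identity functor, the
    transition itself is an identity. The unit law of [pc_name] needs this. *)
Lemma pc_tau_id F (A : PCOb F) (X : C) : is_identity (pc_tau A (idm X)).
Proof.
have e0 (a : F X) : pf_map F (idm X) a = a by rewrite pf_id.
have [e1 He] := pf_phi_idl (idm X) (A X).
have := pc_tau_comp A (idm X) (idm X).
have e2 : pf_map F (idm X ∘ idm X) (A X) = pf_map F (idm X) (A X) by rewrite comp_idl.
rewrite (@pc_tau_can F A X X _ _ (comp_idl (idm X)) e2) He comp_assoc can_comp => /iso_cancel H.
exists (e0 _).
have := functor_eq_nat (pf_id F X) (fwd (pc_tau A (idm X))) (e0 _) (e0 _).
rewrite -H can_comp /= => Ht.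
rewrite -[LHS]comp_idr -(can_sym_r (e0 (pf_map F (idm X) (A X)))) -comp_assoc -Ht can_comp.
exact: can_irr.
Qed.

Lemma is_identity_bwd (D : Category) (a b : D) (i : Iso a b) : is_identity i -> is_identity (bwd i).
Proof.
move=> [e H]; exists (eq_sym e); apply: (@iso_cancel _ _ _ _ i).
by rewrite fwd_bwd H can_sym_r.
Qed.

(** The structure isomorphisms of a pseudonatural transformation run opposite to the transitions of
    [A], hence the inverses. *)
Definition pc_name F (A : PCOb F) : PseudoNat pf_unit F.
Proof.
refine {| pn_fun := fun X => FConst UnitCat (A X) : Functor (pf_unit X) (F X);
          pn_iso := fun X Y f _ => iso_inv (pc_tau A f) |}.
- abstract (by move=> X Y f a b u /=; rewrite fmap_id comp_idl comp_idr).
- abstract (move=> X Y Z f g a /=; rewrite comp_idr;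
    by rewrite -[RHS](@iso_swap _ _ _ _ _ (iso_comp (pc_tau A f) (fmap_iso (pf_map F f) (pc_tau A g)))
      (pc_tau A (g ∘ f)) (pf_phi F f g (A Z)) (idm (A X))) ?comp_idr ?comp_idl //= pc_tau_comp).
- abstract (by move=> X a; apply: is_identity_bwd; exact: pc_tau_id).
Defined.

Definition pc_eval F : Functor (PNCat pf_unit F) (PC0 F).
Proof.
refine {| fob := fun h : PNCat pf_unit F => pc_fun_ob h pc_pt : PC0 F;
          fmap := fun h k s => pc_md_at s pc_pt |}.
- abstract (by move=> h; apply: pc_hom_eq).
- abstract (by move=> *; apply: pc_hom_eq).
Defined.

Definition pc_uneval F (h k : PseudoNat pf_unit F) (m : PCHom (pc_fun_ob h pc_pt) (pc_fun_ob k pc_pt)) :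
  Modification h k.
Proof.
unshelve refine {| md_nt := fun X => {| nt := fun a : pf_unit X =>
   match a return hom (pn_fun h X a) (pn_fun k X a) with tt => m X end |} |}.
- abstract (by move=> [] [] []; rewrite (fmap_id (pn_fun h X) tt) (fmap_id (pn_fun k X) tt)
    comp_idl comp_idr).
(* Transitions of an evaluated 1-cell are inverses of its structure isomorphisms, so the square of
   [m] has to be turned around. *)
- abstract (move=> X Y f [] /=;
  apply: (@iso_swap _ _ _ _ _ (iso_inv (pn_iso h f tt)) (iso_inv (pn_iso k f tt)));
  move: (pc_mor_tau m f); rewrite /= (fmap_id (pn_fun h X) tt) (fmap_id (pn_fun k X) tt);
  by rewrite !comp_idl).
Defined.

Lemma pc_evalK F (h k : PseudoNat pf_unit F) (m : PCHom (pc_fun_ob h pc_pt) (pc_fun_ob k pc_pt)) :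
  pc_md_at (pc_uneval m) pc_pt = m.
Proof. exact: pc_hom_eq. Qed.

Lemma pc_unevalK F (h k : PseudoNat pf_unit F) (s : Modification h k) :
  pc_uneval (pc_md_at s pc_pt) = s.
Proof. by apply: md_eq => X []. Qed.

Lemma pc_eval_name F (A : PCOb F) : pc_fun_ob (pc_name A) pc_pt = A.
Proof.
unshelve eapply pc_ob_eq => // X Y f e /=.
by rewrite can_loop !comp_idl comp_idr.
Qed.

Lemma pc_is_power F (h k l : PNCat pf_unit F) (q : hom h k) (r : hom l k) n
    (u : Fin.t n -> hom l h) :
  IsPower q r u ->
  IsPower (fmap (pc_eval F) q) (fmap (pc_eval F) r) (fun i => fmap (pc_eval F) (u i)).
Proof.
move=> H; refine (@ff_is_power (PNCat pf_unit F) (PC0 F) (pc_eval F) (@pc_uneval F)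
  (@pc_evalK F) (@pc_unevalK F) _ _ _ _ _ _ _ _ H) => A.
exists (pc_name A); exact: pc_eval_name.
Qed.

Lemma pc_is_pullback F (h k l m : PNCat pf_unit F)
    (u : hom h k) (v : hom h l) (f : hom k m) (g : hom l m) :
  IsPullback u v f g ->
  IsPullback (fmap (pc_eval F) u) (fmap (pc_eval F) v) (fmap (pc_eval F) f) (fmap (pc_eval F) g).
Proof.
move=> H; refine (@ff_is_pullback (PNCat pf_unit F) (PC0 F) (pc_eval F) (@pc_uneval F)
  (@pc_evalK F) (@pc_unevalK F) _ _ _ _ _ _ _ _ _ H) => A.
exists (pc_name A); exact: pc_eval_name.
Qed.

Lemma pc_eval_comp F E (h : PseudoNat F E) (A : PCOb F) :
  pc_fun_ob (pn_comp h (pc_name A)) pc_pt = pc_fun_ob h A.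
Proof. by rewrite PC_comp_ob pc_eval_name. Qed.

(** Evaluating the diagram whiskered with the name of [A] gives the diagram at [A]. Its objects
    match only up to [pc_eval_comp], and [is_power_iso] absorbs these equalities. *)
Lemma pc_is_power_at F E (h k l : PseudoNat F E) (q : Modification h k) (r : Modification l k) n
    (u : Fin.t n -> Modification l h) (A : PCOb F) :
  @IsPower (PNCat pf_unit E) _ _ (@wr (Bicat C) _ _ _ _ _ q (pc_name A)) n _
    (@wr (Bicat C) _ _ _ _ _ r (pc_name A)) (fun i => @wr (Bicat C) _ _ _ _ _ (u i) (pc_name A)) ->
  @IsPower (PC0 E) _ _ (pc_md_at q A) n _ (pc_md_at r A) (fun i => pc_md_at (u i) A).
Proof.
move/pc_is_power => H.
refine (@is_power_iso (PC0 E) _ _ _ _ _ _ _ _ _ _ n _ _ (@can_iso (PC0 E) _ _ (pc_eval_comp h A))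
  (@can_iso (PC0 E) _ _ (pc_eval_comp k A)) (@can_iso (PC0 E) _ _ (pc_eval_comp l A))
  _ _ _ H) => [||i];
  unshelve eapply pc_can_nat => //= X; by rewrite fmap_id comp_idl !comp_idr.
Qed.

Lemma pc_is_pullback_at F E (h k l m : PseudoNat F E) (u : Modification h k)
    (v : Modification h l) (f : Modification k m) (g : Modification l m) (A : PCOb F) :
  @IsPullback (PNCat pf_unit E) _ _ _ _ (@wr (Bicat C) _ _ _ _ _ u (pc_name A))
    (@wr (Bicat C) _ _ _ _ _ v (pc_name A)) (@wr (Bicat C) _ _ _ _ _ f (pc_name A))
    (@wr (Bicat C) _ _ _ _ _ g (pc_name A)) ->
  @IsPullback (PC0 E) _ _ _ _ (pc_md_at u A) (pc_md_at v A) (pc_md_at f A) (pc_md_at g A).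
Proof.
move/pc_is_pullback => H.
refine (@is_pullback_iso (PC0 E) _ _ _ _ _ _ _ _ _ _ _ _ _ _ _ _ (@can_iso (PC0 E) _ _ (pc_eval_comp h A))
  (@can_iso (PC0 E) _ _ (pc_eval_comp k A)) (@can_iso (PC0 E) _ _ (pc_eval_comp l A))
  (@can_iso (PC0 E) _ _ (pc_eval_comp m A)) _ _ _ _ H);
  unshelve eapply pc_can_nat => //= X; by rewrite fmap_id comp_idl !comp_idr.
Qed.
End Representation.

(** * The tangent category of a tangent object *)

Section TangentCategory.
Context {C : Category} (d : TanData (Bicat C)) (H : IsTangentObject d).
Let F : PseudoFunctor C := td_ob d.
Let u := map_data (PC C) d.
Let T : PseudoNat F F := td_T d.

(** In this and the next lemmas unitors and associators have identity components, so each whiskering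
    reduces to the objectwise expression in the axioms of a tangent category. *)
Lemma md_Tp (X : C) (a : F X) :
  md_nt (td_Tp d) X a = fmap (pn_fun T X) (md_nt (td_p d) X a).
Proof.
rewrite /td_Tp /run /=. 
rewrite (@md_can C F F _ _ (comp1_idr (td_T d)) X a (eq_refl (pn_fun T X a))) /=.
by rewrite !comp_idl.
Qed.
Lemma md_pT (X : C) (a : F X) :
  md_nt (td_pT d) X a = md_nt (td_p d) X (pn_fun T X a).
Proof.
rewrite /td_pT /lun /=. 
rewrite (@md_can C F F _ _ (comp1_idl (td_T d)) X a (eq_refl (pn_fun T X a))) /=.
by rewrite !comp_idl fmap_id comp_idr.
Qed.
Lemma md_T0 (X : C) (a : F X) :
  md_nt (td_T0 d) X a = fmap (pn_fun T X) (md_nt (td_0 d) X a).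
Proof.
rewrite /td_T0 /runi /=. 
rewrite (@md_can C F F _ _ (eq_sym (comp1_idr (td_T d))) X a (eq_refl (pn_fun T X a))) /=.
by rewrite !comp_idl comp_idr.
Qed.
Lemma md_0T (X : C) (a : F X) :
  md_nt (td_0T d) X a = md_nt (td_0 d) X (pn_fun T X a).
Proof.
rewrite /td_0T /luni /=. 
rewrite (@md_can C F F _ _ (eq_sym (comp1_idl (td_T d))) X a (eq_refl (pn_fun T X a))) /=.
by rewrite !comp_idr.
Qed.
Lemma md_lT (X : C) (a : F X) :
  md_nt (td_lT d) X a = md_nt (td_l d) X (pn_fun T X a).
Proof.
rewrite /td_lT /asc /=. 
rewrite (@md_can C F F _ _ (comp1_assoc (td_T d) (td_T d) (td_T d)) X a
  (eq_refl (pn_fun T X (pn_fun T X (pn_fun T X a))))) /=.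
by rewrite !fmap_id comp_idl comp_idr.
Qed.
Lemma md_cT (X : C) (a : F X) :
  md_nt (td_cT d) X a = md_nt (td_c d) X (pn_fun T X a).
Proof.
rewrite /td_cT /asc /asci /=. 
rewrite (@md_can C F F _ _ (comp1_assoc (td_T d) (td_T d) (td_T d)) X a
  (eq_refl (pn_fun T X (pn_fun T X (pn_fun T X a))))) /=.
rewrite (@md_can C F F _ _ (eq_sym (comp1_assoc (td_T d) (td_T d) (td_T d))) X a
  (eq_refl (pn_fun T X (pn_fun T X (pn_fun T X a))))) /=.
by rewrite !fmap_id comp_idl !comp_idr.
Qed.
Lemma md_Tl (X : C) (a : F X) :
  md_nt (td_Tl d) X a = fmap (pn_fun T X) (md_nt (td_l d) X a).
Proof. exact: comp_idl. Qed.
Lemma md_Tc (X : C) (a : F X) :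
  md_nt (td_Tc d) X a = fmap (pn_fun T X) (md_nt (td_c d) X a).
Proof. exact: comp_idl. Qed.

(** * Pullback powers in the category of the pseudofunctor *)

Lemma map_data_base (n : nat) (A : PCOb F) (X : C) :
  pc_mor (nt (td_base u n) A : PCHom (pc_fun_ob (td_Tn d n) A) A) X = md_nt (td_base d n) X (A X).
Proof.
refine (eq_trans (f_equal (fun x => comp (x : hom (A X) (A X)) (md_nt (td_base d n) X (A X)))
  (@pc_nt_can _ _ _ _ _ (tf_id (PC C) (td_ob d)) A X (eq_refl (A X)))) (comp_idl _)).
Qed.

Lemma tf_pow1 (m : nat) : tf1 (PC C) (pow1 (td_T d) m) = FPow (td_T u) m.
Proof.
elim: m => [|m IH]; first exact: tf_id.
by rewrite [LHS](tf_comp1 (PC C)) IH.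
Qed.

Lemma pc_power (m n : nat) (A : PC0 F) :
  IsPower (fmap (FPow (td_T u) m) (nt (td_p u) A)) (fmap (FPow (td_T u) m) (nt (td_base u n) A))
          (fun i => fmap (FPow (td_T u) m) (nt (td_pr u n i) A)).
Proof.
rewrite -tf_pow1.
pose Tm : PseudoNat F F := pow1 (td_T d) m.
have Hp : @IsPower (PC0 F) _ _ (pc_md_at (@wl (Bicat C) _ _ _ Tm _ _ (td_p d)) A) n _
    (pc_md_at (@wl (Bicat C) _ _ _ Tm _ _ (td_base d n)) A)
    (fun i => pc_md_at (@wl (Bicat C) _ _ _ Tm _ _ (td_pr d n i)) A).
  exact: pc_is_power_at (is_power_pow1 m n (pc_name A : cell1 (pf_unit : Bicat C) d) H).
(* Applying a composite of 1-cells to [A] agrees with applying them in turn only propositionally;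
   the resulting isomorphisms have identity components. *)
have e k : pc_fun_ob (pn_comp Tm k) A = pc_fun_ob Tm (pc_fun_ob k A) by exact: PC_comp_ob.
have e1 : pc_fun_ob (pn_comp Tm (pn_id F)) A = pc_fun_ob Tm A by rewrite e PC_id_ob.
refine (@is_power_iso (PC0 F) _ _ _ _ _ _ _ _ _ _ n _ _ (@can_iso (PC0 F) _ _ (e T))
  (@can_iso (PC0 F) _ _ e1) (@can_iso (PC0 F) _ _ (e (td_Tn d n))) _ _ _ Hp) => [||i].
- unshelve eapply pc_can_nat => //= X; rewrite !comp_idl comp_idr.
  congr (fmap _ _); symmetry; exact: map_data_p.
- unshelve eapply pc_can_nat => //= X; rewrite !comp_idl comp_idr.
  congr (fmap _ _); symmetry; exact: map_data_base.
- by unshelve eapply pc_can_nat => //= X; rewrite !comp_idl comp_idr.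
Qed.

(** * Componentwise transfer of the axioms *)

Lemma md_at (h k : PseudoNat F F) (s t : Modification h k) :
  s = t -> forall (A : PCOb F) X, md_nt s X (A X) = md_nt t X (A X).
Proof. by move=> ->. Qed.

(** Supplies the pairing maps into [T T_2]. The component of [w] at [A] lands in a different term
    for the target, and correcting it by [PC_comp_ob] leaves the components unchanged. *)
Lemma pc_md_comp (h k k' : PseudoNat F F) (w : Modification h (pn_comp k k')) (A : PCOb F) :
  exists v : PCHom (pc_fun_ob h A) (pc_fun_ob k (pc_fun_ob k' A)),
    forall X, v X = md_nt w X (A X).
Proof.
exists (@comp (PC0 F) _ _ _ (@can (PC0 F) _ _ (PC_comp_ob k k' A)) (pc_md_at w A)) => X /=.
by rewrite (@pc_can _ _ _ _ (PC_comp_ob k k' A) X eq_refl) comp_idl.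
Qed.

Lemma pc_md_conj (h h' k k' : PseudoNat F F)
    (w : Modification (pn_comp h h') (pn_comp k k')) (A : PCOb F) :
  exists v : PCHom (pc_fun_ob h (pc_fun_ob h' A)) (pc_fun_ob k (pc_fun_ob k' A)),
    forall X, v X = md_nt w X (A X).
Proof.
have [v Hv] := pc_md_comp w A.
exists (@comp (PC0 F) _ _ _ v (@can (PC0 F) _ _ (eq_sym (PC_comp_ob h h' A)))) => X /=.
by rewrite Hv (@pc_can _ _ _ _ (eq_sym (PC_comp_ob h h' A)) X eq_refl) comp_idr.
Qed.

(** The structure maps are arbitrary with prescribed components, which keeps the identities inside
    [map_data] out of the verification. Each equation is then an instance, at every [X] and [A X],
    of the one for the tangent object. *)
Lemma pc_tangent_structure (p : NatTrans (pc_fun T) (FId (PC0 F)))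
    (z : NatTrans (FId (PC0 F)) (pc_fun T))
    (base : forall n, NatTrans (pc_fun (td_Tn d n)) (FId (PC0 F)))
    (l : NatTrans (pc_fun T) (pc_fun T ∘F pc_fun T))
    (c : NatTrans (pc_fun T ∘F pc_fun T) (pc_fun T ∘F pc_fun T)) :
  (forall (A : PCOb F) X, pc_mor (nt p A) X = md_nt (td_p d) X (A X)) ->
  (forall (A : PCOb F) X, pc_mor (nt z A) X = md_nt (td_0 d) X (A X)) ->
  (forall (A : PCOb F) X, pc_mor (nt l A) X = md_nt (td_l d) X (A X)) ->
  (forall (A : PCOb F) X, pc_mor (nt c A) X = md_nt (td_c d) X (A X)) ->
  (forall (m n : nat) (A : PC0 F),
    IsPower (fmap (FPow (pc_fun T) m) (p A)) (fmap (FPow (pc_fun T) m) (base n A))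
            (fun i => fmap (FPow (pc_fun T) m) (pc_md (td_pr d n i) A))) ->
  @IsTangentStructure (PC0 F) (pc_fun T) p z (fun n => pc_fun (td_Tn d n)) base
    (fun n i => pc_md (td_pr d n i)) (pc_md (td_add d)) l c.
Proof.
move=> Hp Hz Hl Hc Hpow; split=> //.
- move=> A; case: (to_monoid H) => [m1 m2 [w [[m3 m4] m5]] [w' [[m6 m7] m8]]
    [w01 [w12 [lw [rw [[a1 a2] [[b1 b2] [[c1 c2] [[d1 d2] m9]]]]]]]]]; split.
  + by move=> i; apply: pc_hom_eq => X /=; rewrite Hp; apply: (md_at (m1 i)).
  + by apply: pc_hom_eq => X /=; rewrite Hp Hz; apply: (md_at m2).
  + exists (pc_md_at w A); split; first split; apply: pc_hom_eq => X /=; rewrite ?Hp ?Hz.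
    * exact: (md_at m3).
    * exact: (md_at m4).
    * exact: (md_at m5).
  + exists (pc_md_at w' A); split; first split; apply: pc_hom_eq => X /=.
    * exact: (md_at m6).
    * exact: (md_at m7).
    * exact: (md_at m8).
  + exists (pc_md_at w01 A), (pc_md_at w12 A), (pc_md_at lw A), (pc_md_at rw A).
    split; [|split; [|split; [|split]]]; last by apply: pc_hom_eq => X; apply: (md_at m9).
    * by split; apply: pc_hom_eq => X; [apply: (md_at a1) | apply: (md_at a2)].
    * by split; apply: pc_hom_eq => X; [apply: (md_at b1) | apply: (md_at b2)].
    * by split; apply: pc_hom_eq => X; [apply: (md_at c1) | apply: (md_at c2)].
    * by split; apply: pc_hom_eq => X; [apply: (md_at d1) | apply: (md_at d2)].
- move=> A; apply: pc_hom_eq => X /=; rewrite Hp Hl Hz /= -?md_Tp.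
  exact: (md_at (to_l_p H) A X).
- move=> A; case: (to_l_add H) => w [[w1 w2] w3].
  have [v Hv] := pc_md_comp w A.
  exists v; split; first split; apply: pc_hom_eq => X /=; rewrite Hl Hv.
  (* A component of a left whiskering is an identity composed with an image under [T]; restoring
     that identity exposes the component of [w1]. *)
  + rewrite -[fmap _ (md_nt (td_pr d 2 _) X _)]comp_idl; exact: (md_at w1 A X).
  + rewrite -[fmap _ (md_nt (td_pr d 2 _) X _)]comp_idl; exact: (md_at w2 A X).
  + rewrite -[fmap _ (md_nt (td_add d) X _)]comp_idl; exact: (md_at w3 A X).
- move=> A; apply: pc_hom_eq => X /=; rewrite Hl Hz /= -?md_T0.
  exact: (md_at (to_l_0 H) A X).
- move=> A; apply: pc_hom_eq => X /=; rewrite !Hp Hc /= -?md_Tp -?md_pT.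
  exact: (md_at (to_c_p H) A X).
- move=> A; case: (to_c_add H) => w [[w1 w2] w3].
  have [v Hv] := pc_md_conj w A.
  exists v; split; first split; apply: pc_hom_eq => X /=; rewrite Hc Hv.
  + rewrite -[fmap _ (md_nt (td_pr d 2 _) X _)]comp_idl.
    (* A right whiskering has as component a component at [T A] preceded by the image of an
       identity, which is restored here. *)
    rewrite -[md_nt (td_pr d 2 _) X _]comp_idr -(fmap_id (pn_fun (td_Tn d 2) X)).
    exact: (md_at w1 A X).
  + rewrite -[fmap _ (md_nt (td_pr d 2 _) X _)]comp_idl.
    rewrite -[md_nt (td_pr d 2 _) X _]comp_idr -(fmap_id (pn_fun (td_Tn d 2) X)).
    exact: (md_at w2 A X).
  + rewrite -[fmap _ (md_nt (td_add d) X _)]comp_idl.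
    rewrite -[md_nt (td_add d) X (pn_fun T X _)]comp_idr -(fmap_id (pn_fun (td_Tn d 2) X)).
    exact: (md_at w3 A X).
- move=> A; apply: pc_hom_eq => X /=; rewrite Hc !Hz /= -?md_T0 -?md_0T.
  exact: (md_at (to_c_0 H) A X).
- move=> A; apply: pc_hom_eq => X /=; rewrite Hc; exact: (md_at (to_c_c H) A X).
- move=> A; apply: pc_hom_eq => X /=; rewrite Hc Hl; exact: (md_at (to_c_l H) A X).
- move=> A; apply: pc_hom_eq => X /=; rewrite !Hl /= -?md_Tl -?md_lT.
  exact: (md_at (to_l_l H) A X).
- move=> A; apply: pc_hom_eq => X /=; rewrite !Hc /= -?md_Tc -?md_cT.
  exact: (md_at (to_c_braid H) A X).
- move=> A; apply: pc_hom_eq => X /=; rewrite !Hc !Hl /= -?md_Tc -?md_cT -?md_lT -?md_Tl.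
  exact: (md_at (to_c_c_l H) A X).
- move=> A; case: (to_lift H) => w [[w1 w2] [_ w3]].
  have [v Hv] := pc_md_comp w A.
  exists v; split.
  + split; apply: pc_hom_eq => X /=; rewrite ?Hl ?Hz Hv.
    * rewrite -[fmap _ (md_nt (td_pr d 2 _) X _)]comp_idl; exact: (md_at w1 A X).
    * rewrite -[fmap _ (md_nt (td_pr d 2 _) X _)]comp_idl -?md_0T; exact: (md_at w2 A X).
  (* The retraction is [p A]. Naturality of [p] identifies [p] after [T p] with [p] after [p T], the
     map followed by [0] in the equalizer axiom. *)
  + rewrite comp_assoc; apply: (@is_equalizer_pullback (PC0 F) _ _ _ _ _
    (p A ∘ pc_md (td_pr d 2 fst2) A) _ _ _ (p A)).
    * apply: pc_hom_eq => X /=; rewrite Hp Hz; exact: (md_at (cm_zero_over (to_monoid H))).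
    * exact: (nt_nat p (p A)).
    (* The pointwise clause of the lift axiom is taken at the name of [A]; what remains is to match
       corners and edges. *)
    * have := pc_is_pullback_at (w3 _ (pc_name A : cell1 (pf_unit : Bicat C) d)).
      apply: (@is_pullback_iso (PC0 F) _ _ _ _ _ _ _ _ _ _ _ _ _ _ _ _ (iso_id _)
        (@can_iso (PC0 F) _ _ (PC_comp_ob T T A)) (@can_iso (PC0 F) _ _ (PC_id_ob A)) (iso_id _));
        apply: pc_hom_eq => X.
      -- by rewrite /= (@pc_can _ _ _ _ (PC_comp_ob T T A) X eq_refl) Hv !comp_idl comp_idr.
      -- by rewrite /= (@pc_can _ _ _ _ (PC_id_ob A) X eq_refl) Hp comp_idl comp_idr.
      -- transitivity (md_nt (td_Tp d) X (A X)); first exact: comp_idl.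
         by rewrite md_Tp /= (@pc_can _ _ _ _ (PC_comp_ob T T A) X eq_refl) Hp comp_idr.
      -- by rewrite /= (@pc_can _ _ _ _ (PC_id_ob A) X eq_refl) Hz comp_idl comp_idr.
Qed.

Lemma pc_tangent_category : IsTangentCategory u.
Proof.
exact (@pc_tangent_structure (td_p u) (td_0 u) (td_base u) (td_l u) (td_c u)
  (@map_data_p C d) (@map_data_0 C d) (@map_data_l C d) (@map_data_c C d) pc_power).
Qed.
End TangentCategory.

Theorem theorem4p8 (C : Category) :
  exists L : TwoFunctor (Tan (Bicat C)) TanCat,
    TFComp Forget_TanCat L = TFComp (PC C) (Forget_Tan (Bicat C)) /\
    (forall X : Tan (Bicat C), tancat_data (L X) = map_data (PC C) (tan_data X)) /\
    (forall (X Y : Tan (Bicat C)) (f : cell1 X Y),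
       square_of (fob (tf1 L) f) = map_square (PC C) (square_of f)).
Proof.
exists (TanLift (@pc_tangent_category C)); split; first exact: tan_lift_forget.
(* Both descriptions hold by computation, from the definitions of [TanLift] and [tf_sq]. *)
by split.
Qed.
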